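(* Let $\mu=2(9+\sqrt{11})/35$. Let $\xi\in\mathbb{R}$ and let $\tau>1/(1-\mu)\cong 3.376$. Suppose that, for each sufficiently large real number $X$, there exists a non-zero polynomial $P(T)=aT^3+bT+c\in\mathbb{Z}[T]$ with $\max\{|a|,|b|,|c|\}\le X$ and $|P(\xi)|\le X^{-\tau}$. Then $1,\xi,\xi^3$ are linearly dependent over $\mathbb{Q}$. *)

(* Defs.v *)
From HB Require Import structures.
From mathcomp Require Import all_boot all_order all_algebra.
From mathcomp Require Import all_classical all_reals all_analysis.
Set Implicit Arguments.
Unset Strict Implicit.
Unset Printing Implicit Defensive.
Import Order.TTheory GRing.Theory Num.Theory.
Import numFieldNormedType.Exports.
Local Open Scope ring_scope.

(* The library's [free] needs a finite-dimensional [vectType], which the reals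
   are not over [rat]; hence this direct definition for finite families. *)
Definition rat_lin_dependent (R : realType) (n : nat) (v : n.-tuple R) : Prop :=
  exists q : 'I_n -> rat,
    (exists i, q i != 0) /\ \sum_(i < n) ratr (q i) * tnth v i = 0.

(* Main.v *)
Require Import Defs.
From HB Require Import structures.
From mathcomp Require Import all_boot all_order all_algebra.
From mathcomp Require Import all_classical all_reals all_analysis.
From mathcomp Require Import zify ring lra.
Import Order.TTheory GRing.Theory Num.Theory.
Import numFieldNormedType.Exports.
Local Open Scope ring_scope.

(* Suppose 1, xi, xi^3 are independent over Q and identify a form
   c + b T + a T^3 with its coefficient vector.  Consecutive forms of minimal
   absolute value at xi yield integer points x_k approximating (1, xi, xi^3),
   with x_k and x_(k+1) spanning a plane normal to a minimal form P_k.  On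
   (s, t) |-> s x_k + t x_(k+1) the cuspidal cubic x0^2 x2 - x1^3 restricts to a
   binary cubic with coefficients a, b, c, d.  Put K = 4 a c - b^2 and
   D = a^2 d.  As x_k and x_(k+1) have index n in their plane, the monic cubic
   S^3 + b S^2 + a c S + D is close to a cube modulo n, and this makes n^2, n^3
   and n^6 divide small multiples of
     K^3 - 27 D^2,   K^3 - 18 b K D + 135 D^2   and
     b K^4 - 11 b^2 K^2 D - b^3 D^2 - 10 K^3 D + 180 b K D^2 - 675 D^3.
   Since x_k and x_(k+1) are close to the curve, these integers are also small;
   when one of them is smaller than the corresponding power of n it vanishes,
   which is impossible.  So |x_(k+1)| is large compared with |x_k|; fed back
   into |x_(k+1)| << |P_k| |P_(k+1)|, this forces log |P_k| / log |x_k| to grow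
   beyond its upper bound 2 / (tau - 1), as soon as
   7 (tau - 1)^2 - 20 (tau - 1) + 8 > 0. *)

Set Implicit Arguments.
Unset Strict Implicit.
Unset Printing Implicit Defensive.

(** * Ternary integer vectors and the cubic form *)

(** Give [b], [K], [D] the weights 1, 2, 3. A cube has 3 K = b^2 and 27 D = b^3, and the restricted
    cubic departs from this by terms in n^2 and n^3. As K and D are small compared with b, monomials
    with few factors b are the useful ones; each of the three integers combines such monomials so
    that all contributions below n^2, n^3 or n^6 cancel. The vanishing of either of the first two is
    contradictory by arithmetic. That of the third only gives K^2 << |b D|, which is the bound on
    K^3 that the second one needs when the size of K alone does not suffice. The integers are small
    only if h / u = log |P_k| / log |x_k| is already large. Hence a bootstrap: the thresholds 7/10,
    11/14, 31/38 in successive inequalities are each supplied by the preceding one. The last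
    inequality turns a lower bound r for h / u into about 1 - 3 r / (A r - 1) with A = 11 (tau - 1)
    - 6, and the quadratic condition keeps this map from having a fixed point between 8/10 and 2 /
    (tau - 1). *)

Notation vec := (int * int * int)%type.

Definition dot (u v : vec) : int := u.1.1 * v.1.1 + u.1.2 * v.1.2 + u.2 * v.2.

Definition cross (u v : vec) : vec :=
  (u.1.2 * v.2 - u.2 * v.1.2, u.2 * v.1.1 - u.1.1 * v.2,
   u.1.1 * v.1.2 - u.1.2 * v.1.1).

Definition scale (n : int) (u : vec) : vec := (n * u.1.1, n * u.1.2, n * u.2).

(** Coprimality is stated by a Bezout vector because that vector supplies the multiplier in
    [cross_lift]. *)
Definition primitive (u : vec) : Prop := exists r, dot r u = 1.

Definition cubic (x : vec) : int := x.1.1 ^+ 2 * x.2 - x.1.2 ^+ 3.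

(* The coefficient of [s ^+ 2 * t] in [cubic (s x + t z)]. *)
Definition polar (x z : vec) : int :=
  x.1.1 ^+ 2 * z.2 + 2 * x.1.1 * x.2 * z.1.1 - 3 * x.1.2 ^+ 2 * z.1.2.

Lemma vec_eqP (u v : vec) :
  u.1.1 = v.1.1 -> u.1.2 = v.1.2 -> u.2 = v.2 -> u = v.
Proof. by case: u => [[? ?] ?]; case: v => [[? ?] ?] /= -> -> ->. Qed.

Lemma primitive_neq0 (u : vec) : primitive u -> u != 0.
Proof.
by case=> r hr; apply/eqP => u0; move: hr; rewrite u0 /dot /=; lia.
Qed.

Lemma primitive_gcd (u : vec) : u != 0 ->
  exists (g : int) (v : vec), [/\ 0 < g, primitive v & u = scale g v].
Proof.
case: u => [[u0 u1] u2] un0.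
have [[p q] /= hpq] : exists pq : int * int, pq.1 * u0 + pq.2 * u1 = gcdz u0 u1.
  by have [p [q h]] := Bezoutz u0 u1; exists (p, q).
set g1 := gcdz u0 u1 in hpq.
have [[k l] /= hkl] : exists kl : int * int, kl.1 * g1 + kl.2 * u2 = gcdz g1 u2.
  by have [k [l h]] := Bezoutz g1 u2; exists (k, l).
set g := gcdz g1 u2 in hkl.
have /dvdzP[v2 h2] : (g %| u2)%Z by exact: dvdz_gcdr.
have /dvdzP[w hw] : (g %| g1)%Z by exact: dvdz_gcdl.
have /dvdzP[v0 h0] : (g1 %| u0)%Z by exact: dvdz_gcdl.
have /dvdzP[v1 h1] : (g1 %| u1)%Z by exact: dvdz_gcdr.
have gn0 : g != 0.
  apply: contra un0 => /eqP g0; apply/eqP; apply: vec_eqP => /=.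
  - by rewrite h0 hw g0 !mulr0.
  - by rewrite h1 hw g0 !mulr0.
  - by rewrite h2 g0 mulr0.
exists g, (v0 * w, v1 * w, v2); split.
- by rewrite lt_def gn0 /g /gcdz.
- exists (k * p, k * q, l); rewrite /dot /=.
  apply: (mulIf gn0); rewrite mul1r -[RHS]hkl -hpq h0 h1 h2 hw; ring.
- by rewrite /scale /=; apply: vec_eqP => /=; rewrite ?h0 ?h1 ?h2 ?hw; ring.
Qed.

(** The triple product identity cross (cross x z) r = (r . x) z - (r . z) x, with y = cross P r:
    modulo [n], z is a multiple of x. *)
Lemma cross_lift (n : int) (P x z r : vec) :
  cross x z = scale n P -> dot r x = 1 ->
  exists y, [/\ z.1.1 = n * y.1.1 + dot r z * x.1.1,
                z.1.2 = n * y.1.2 + dot r z * x.1.2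
              & z.2 = n * y.2 + dot r z * x.2].
Proof.
case: P x z r => [[P0 P1] P2] [[x0 x1] x2] [[z0 z1] z2] [[r0 r1] r2].
rewrite /cross /scale /dot /= => -[h0 h1 h2] rx.
exists (P1 * r2 - P2 * r1, P2 * r0 - P0 * r2, P0 * r1 - P1 * r0).
rewrite /= !mulrBr !mulrA -h0 -h1 -h2.
by split; rewrite -[LHS]mulr1 -rx; ring.
Qed.

Lemma cross_primitive (P x z : vec) : primitive P -> dot P x = 0 ->
  dot P z = 0 -> exists n, cross x z = scale n P.
Proof.
case: P x z => [[P0 P1] P2] [[x0 x1] x2] [[z0 z1] z2] [[[r0 r1] r2]].
set x := (_, _, x2); set z := (_, _, z2); rewrite /dot /= => hr hx hz.
set P := (_, _, _) in hr *; exists (dot (r0, r1, r2) (cross x z)).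
have P1E w : w = w * (r0 * P0 + r1 * P1 + r2 * P2) by rewrite hr mulr1.
apply: vec_eqP; rewrite /= [LHS]P1E /dot /=; apply/eqP; rewrite -subr_eq0; apply/eqP.
- transitivity ((r2 * x1 - r1 * x2) * (P0 * z0 + P1 * z1 + P2 * z2)
    - (r2 * z1 - r1 * z2) * (P0 * x0 + P1 * x1 + P2 * x2)); first by ring.
  by rewrite hx hz !mulr0 subr0.
- transitivity ((r0 * x2 - r2 * x0) * (P0 * z0 + P1 * z1 + P2 * z2)
    - (r0 * z2 - r2 * z0) * (P0 * x0 + P1 * x1 + P2 * x2)); first by ring.
  by rewrite hx hz !mulr0 subr0.
- transitivity ((r1 * x0 - r0 * x1) * (P0 * z0 + P1 * z1 + P2 * z2)
    - (r1 * z0 - r0 * z1) * (P0 * x0 + P1 * x1 + P2 * x2)); first by ring.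
  by rewrite hx hz !mulr0 subr0.
Qed.

(* The binary cubic [cubic (s x + t z)] scaled to be monic is
   [S ^+ 3 + b S ^+ 2 + F S + D] with [K = 4 F - b ^+ 2]; it has a triple root
   modulo [n], in the sense that its seminvariants of degree 2 and 3 are
   divisible by [n ^+ 2] and [n ^+ 3]. *)
Definition near_cube (n b K D : int) : Prop := exists A J,
  3 * K = b ^+ 2 - 4 * (n ^+ 2 * A) /\
  27 * D = b ^+ 3 - 3 * b * (n ^+ 2 * A) + n ^+ 3 * J.

(** With z = n y + m x, the cubic at s x + t z is the cubic at (s + m t) x + n t y. Seminvariants
    ignore the shift by m t, and the factor n multiplies those of degree 2 and 3 by n^2 and n^3; [A]
    and [J] are the seminvariants of the pair x, y. *)
Lemma near_cube_polar (P x z : vec) (n : int) :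
  primitive x -> cross x z = scale n P ->
  near_cube n (polar x z) (4 * cubic x * polar z x - polar x z ^+ 2)
    (cubic x ^+ 2 * cubic z).
Proof.
move=> [r rx] hxz; have [[[y0 y1] y2] /= []] := cross_lift hxz rx.
case: x z rx hxz => [[x0 x1] x2] [[z0 z1] z2] _ _ /=.
move: (dot _ _) => c -> -> ->; rewrite /near_cube.
set x := (x0, _, _); set y := (y0, y1, y2).
exists (polar x y ^+ 2 - 3 * cubic x * polar y x).
exists (2 * polar x y ^+ 3 - 9 * cubic x * polar x y * polar y x
  + 27 * cubic x ^+ 2 * cubic y).
by rewrite /polar /cubic /=; split; ring.
Qed.

(** * Divisibility by powers of the index *)

Section NearCube.
Variables (n b K D : int).
Hypothesis nc : near_cube n b K D.

Lemma near_cube_dvd2 : (n ^+ 2 %| 27 * (K ^+ 3 - 27 * D ^+ 2))%Z.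
Proof.
case: nc => A [J [hK hD]]; apply/dvdzP.
exists (-6 * b ^+ 4 * A + 39 * b ^+ 2 * n ^+ 2 * A ^+ 2 - 64 * n ^+ 4 * A ^+ 3
  - 2 * b ^+ 3 * n * J + 6 * b * n ^+ 3 * A * J - n ^+ 4 * J ^+ 2).
transitivity ((3 * K) ^+ 3 - (27 * D) ^+ 2); first by ring.
by rewrite hK hD; ring.
Qed.

(** Among the combinations of K^3, b K D and D^2, this one cancels both b^6 and b^4 n^2 A, which
    leaves terms in n^3 and above. *)
Lemma near_cube_dvd3 :
  (n ^+ 3 %| 27 * (K ^+ 3 - 18 * b * K * D + 135 * D ^+ 2))%Z.
Proof.
case: nc => A [J [hK hD]]; apply/dvdzP.
exists (21 * n * b ^+ 2 * A ^+ 2 - 64 * n ^+ 3 * A ^+ 3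
  + 4 * b ^+ 3 * J - 6 * n ^+ 2 * b * A * J + 5 * n ^+ 3 * J ^+ 2).
transitivity ((3 * K) ^+ 3 - 6 * b * (3 * K) * (27 * D) + 5 * (27 * D) ^+ 2).
  by ring.
by rewrite hK hD; ring.
Qed.

(** The six monomials have weight 9. Cancelling b^9, b^7 n^2 A, b^6 n^3 J, b^5 n^4 A^2 and b^4 n^5 A
    J puts five linear conditions on six coefficients, so a non-zero combination had to exist. *)
Lemma near_cube_dvd6 :
  (n ^+ 6 %| 729 * (b * K ^+ 4 - 11 * b ^+ 2 * K ^+ 2 * D - b ^+ 3 * D ^+ 2
    - 10 * K ^+ 3 * D + 180 * b * K * D ^+ 2 - 675 * D ^+ 3))%Z.
Proof.
case: nc => A [J [hK hD]]; apply/dvdzP.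
exists (- 125 * b ^+ 3 * A ^+ 3 + 384 * n ^+ 2 * b * A ^+ 4
  - 243 * n * b ^+ 2 * A ^+ 2 * J - 16 * b ^+ 3 * J ^+ 2
  + 640 * n ^+ 3 * A ^+ 3 * J - 15 * n ^+ 2 * b * A * J ^+ 2
  - 25 * n ^+ 3 * J ^+ 3).
transitivity (9 * b * (3 * K) ^+ 4 - 33 * b ^+ 2 * (3 * K) ^+ 2 * (27 * D)
  - b ^+ 3 * (27 * D) ^+ 2 - 10 * (3 * K) ^+ 3 * (27 * D)
  + 60 * b * (3 * K) * (27 * D) ^+ 2 - 25 * (27 * D) ^+ 3).
  by ring.
by rewrite hK hD; ring.
Qed.
End NearCube.

Lemma dvdz_norm_le (m n : int) : (m %| n)%Z -> n != 0 -> `|m| <= `|n|.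
Proof.
move=> mn n0; rewrite -!abszE lez_nat; apply: dvdn_leq; last by rewrite -dvdzE.
by rewrite absz_gt0.
Qed.

Lemma gcdz_cofactors (m n : int) : m != 0 ->
  exists p q, [/\ m = gcdz m n * p, n = gcdz m n * q & coprimez p q].
Proof.
move=> m0; set g := gcdz m n.
have /dvdzP[p hp] : (g %| m)%Z by exact: dvdz_gcdl.
have /dvdzP[q hq] : (g %| n)%Z by exact: dvdz_gcdr.
exists p, q; rewrite !(mulrC g); split=> //.
apply/coprimezP; have [u [v huv]] := Bezoutz m n; exists (u, v) => /=.
have g0 : g != 0 by rewrite gcdz_eq0 negb_and m0.
by apply: (mulIf g0); rewrite mul1r -[RHS]huv hp hq; ring.
Qed.

(** A primitive point of the cuspidal cubic with x0 non-zero is (p^3, p^2 q, q^3) up to sign, and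
    perpendicularity makes q / p a root of c + b T + a T^3. Hence p divides a, or b when a = 0, and
    |x0| = |p|^3. *)
Lemma cubic_eq0_le (x P : vec) (H : int) :
  primitive x -> x.1.1 != 0 -> cubic x = 0 -> P != 0 -> dot P x = 0 ->
  `|P.1.1| <= H -> `|P.1.2| <= H -> `|P.2| <= H -> `|x.1.1| <= H ^+ 3.
Proof.
case: x P => [[x0 x1] x2] [[c b] a]; rewrite /cubic /dot /= => -[[[r0 r1] r2]].
rewrite /dot /= => hr x00 hx P0 hP hc hb ha.
have [p [q [hp hq cpq]]] := gcdz_cofactors x1 x00.
set g := gcdz x0 x1 in hp hq.
have g0 : g != 0 by apply: contraNneq x00; rewrite hp => ->; rewrite mul0r.
have p0 : p != 0 by apply: contraNneq x00; rewrite hp => ->; rewrite mulr0.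
have h2 : p ^+ 2 * x2 = g * q ^+ 3.
  apply: (mulfI (expf_neq0 2 g0)).
  transitivity (x0 ^+ 2 * x2); first by rewrite hp; ring.
  by move/eqP: hx; rewrite subr_eq0 => /eqP ->; rewrite hq; ring.
have cp23 k : coprimez (p ^+ 2) (q ^+ k).
  by rewrite coprimezXl ?coprimezXr.
have /dvdzP[g' hg'] : (p ^+ 2 %| g)%Z.
  by rewrite -(Gauss_dvdzl _ (cp23 3%N)); apply/dvdzP; exists x2; rewrite -h2 mulrC.
have hx2 : x2 = g' * q ^+ 3.
  by apply: (mulfI (expf_neq0 2 p0)); rewrite h2 hg'; ring.
have g'1 : `|g'| = 1.
  have : (g' %| 1)%Z.
    apply/dvdzP; exists (r0 * p ^+ 3 + r1 * p ^+ 2 * q + r2 * q ^+ 3).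
    transitivity (r0 * x0 + r1 * x1 + r2 * x2); first by rewrite hr.
    by rewrite hp hq hx2 hg'; ring.
  by rewrite dvdz1 => /eqP h; rewrite -abszE h.
have hx0 : `|x0| = `|p| ^+ 3.
  by rewrite hp hg' !normrM g'1; ring.
suff pH : `|p| <= H by rewrite hx0 lerXn2r // ?nnegrE // (le_trans _ pH).
have g'0 : g' != 0 by apply: contraPneq g'1 => ->; rewrite normr0.
have hP' : c * p ^+ 3 + b * p ^+ 2 * q + a * q ^+ 3 = 0.
  apply: (mulfI g'0); rewrite mulr0 -[RHS]hP hp hq hx2 hg'; ring.
have /dvdzP[a' ha'] : (p ^+ 2 %| a)%Z.
  rewrite -(Gauss_dvdzl _ (cp23 3%N)); apply/dvdzP; exists (- (c * p + b * q)).
  by apply: subr0_eq; rewrite -[RHS]hP'; ring.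
have [a0|a0] := eqVneq a 0; last first.
  apply: le_trans ha; apply: le_trans (dvdz_norm_le _ a0); last first.
    by apply: dvdz_trans (dvdz_mulr p (dvdzz p)) _; rewrite -expr2 ha' dvdz_mull.
  by [].
have hcb : c * p + b * q = 0.
  apply: (mulfI (expf_neq0 2 p0)); rewrite mulr0 -[RHS]hP' a0; ring.
have pb : (p %| b)%Z.
  rewrite -(Gauss_dvdzl _ cpq); apply/dvdzP; exists (- c).
  by apply: subr0_eq; rewrite -[RHS]hcb; ring.
apply: le_trans hb; apply: dvdz_norm_le => //.
apply: contraNneq P0 => b0; move: hcb; rewrite b0 a0 mul0r addr0 => /eqP.
by rewrite mulf_eq0 (negPf p0) orbF => /eqP ->.
Qed.

(* Dividing [j], [be] and [n] by their common factors makes [n] prime to [j],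
   and then [n ^+ 3] divides a multiple of [be]. *)
Lemma near_triple_root_le (n j be : int) : be != 0 ->
  (n ^+ 2 %| be * (be + 6 * j))%Z ->
  (n ^+ 3 %| be * (be ^+ 2 + 9 * j * be + 54 * j ^+ 2))%Z ->
  j != 0 -> `|n| ^+ 3 <= 36 ^+ 2 * 54 * (j ^+ 2 * `|be|).
Proof.
move=> be0 h2 h3 j0.
have [n0|n0] := eqVneq n 0.
  by rewrite n0 normr0 expr0n; apply: mulr_ge0 => //; apply: mulr_ge0 => //; apply: sqr_ge0.
have [j' [b' [hj hb cjb]]] := gcdz_cofactors be j0.
set g := gcdz j be in hj hb.
have g0 : g != 0 by apply: contraNneq j0; rewrite hj => ->; rewrite mul0r.
have [m [g' [hm hg cmg]]] := gcdz_cofactors g n0.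
set e := gcdz n g in hm hg.
have e0 : e != 0 by apply: contraNneq n0; rewrite hm => ->; rewrite mul0r.
have b'0 : b' != 0 by apply: contraNneq be0; rewrite hb => ->; rewrite mulr0.
have cmgX k l : coprimez (m ^+ k) (g' ^+ l).
  by rewrite coprimezXl ?coprimezXr.
have {}h2 : (m ^+ 2 %| b' * (b' + 6 * j'))%Z.
  rewrite -(Gauss_dvdzr _ (cmgX 2%N 2%N)) -(@dvdz_mul2l (e ^+ 2)) ?expf_neq0 //.
  have -> : e ^+ 2 * m ^+ 2 = n ^+ 2 by rewrite [n in RHS]hm; ring.
  have -> : e ^+ 2 * (g' ^+ 2 * (b' * (b' + 6 * j'))) = be * (be + 6 * j).
    by rewrite hb hj hg; ring.
  by [].
have {}h3 : (m ^+ 3 %| b' * (b' ^+ 2 + 9 * j' * b' + 54 * j' ^+ 2))%Z.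
  rewrite -(Gauss_dvdzr _ (cmgX 3%N 3%N)) -(@dvdz_mul2l (e ^+ 3)) ?expf_neq0 //.
  have -> : e ^+ 3 * m ^+ 3 = n ^+ 3 by rewrite [n in RHS]hm; ring.
  have -> : e ^+ 3 * (g' ^+ 3 * (b' * (b' ^+ 2 + 9 * j' * b' + 54 * j' ^+ 2))) =
      be * (be ^+ 2 + 9 * j * be + 54 * j ^+ 2) by rewrite hb hj hg; ring.
  by [].
have /dvdzP[y hy] := h2.
(* A common factor of m and j' divides b'^2 by [h2], whereas b' is prime to j'. The square of the
   Bezout relation makes this explicit. *)
have cmj : coprimez m j'.
  apply/coprimezP; case/coprimezP: cjb => -[u v] /= huv.
  exists (v ^+ 2 * y * m, u ^+ 2 * j' + 2 * u * v * b' - 6 * v ^+ 2 * b') => /=.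
  transitivity ((u * j' + v * b') ^+ 2); last by rewrite huv.
  transitivity (v ^+ 2 * (y * m ^+ 2) + (u ^+ 2 * j' + 2 * u * v * b' - 6 * v ^+ 2 * b') * j').
    by ring.
  by rewrite -hy; ring.
have cmjX k l : coprimez (m ^+ k) (j' ^+ l).
  by rewrite coprimezXl ?coprimezXr.
(* The quadratic factor of [h3] exceeds (b' + 6 j') (b' + 3 j') by 36 j'^2, and j' is prime to m. *)
have /dvdzP[mu hmu] : (m ^+ 2 %| 36 * b')%Z.
  rewrite -(Gauss_dvdzl _ (cmjX 2%N 2%N)).
  have -> : 36 * b' * j' ^+ 2 = b' * (b' ^+ 2 + 9 * j' * b' + 54 * j' ^+ 2)
    - b' * (b' + 6 * j') * (b' + 3 * j') by ring.
  apply: rpredB; last exact: dvdz_mulr.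
  by apply: dvdz_trans h3; apply: dvdz_exp2l.
have /dvdzP[nu hnu] : (m %| 36 * 54 * mu)%Z.
  rewrite -(Gauss_dvdzl _ (cmjX 1%N 2%N)).
  have : (m %| 36 * (mu * (b' ^+ 2 + 9 * j' * b' + 54 * j' ^+ 2)))%Z.
    rewrite dvdz_mull //.
    have m20 : m ^+ 2 != 0.
      by rewrite expf_neq0 //; apply: contraNneq n0; rewrite hm => ->; rewrite mulr0.
    rewrite -(@dvdz_mul2l (m ^+ 2)) // -exprSr mulrA (mulrC _ mu) -hmu -mulrA.
    by rewrite dvdz_mull.
  have -> : 36 * (mu * (b' ^+ 2 + 9 * j' * b' + 54 * j' ^+ 2)) =
    36 * 54 * mu * j' ^+ 2 + mu * (b' + 9 * j') * (36 * b') by ring.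
  rewrite rpredDr // hmu; apply: dvdz_mull; apply: dvdz_mull.
  by rewrite expr2 dvdz_mulr.
have hb' : 36 ^+ 2 * 54 * b' = nu * m ^+ 3.
  transitivity (36 * 54 * (36 * b')); first by ring.
  by rewrite hmu mulrA hnu; ring.
have eg : `|e| <= `|g| by apply: dvdz_norm_le => //; exact: dvdz_gcdr.
have gj : `|g| <= `|j| by apply: dvdz_norm_le => //; exact: dvdz_gcdl.
have m3 : `|m| ^+ 3 <= 36 ^+ 2 * 54 * `|b'|.
  have -> : 36 ^+ 2 * 54 * `|b'| = `|36 ^+ 2 * 54 * b'|.
    by rewrite !normrM !normr_nat.
  rewrite -normrX; apply: dvdz_norm_le; first by rewrite hb' dvdz_mull.
  by rewrite !mulf_neq0 ?expf_neq0 // pnatr_eq0.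
rewrite hm normrM exprMn.
apply: (@le_trans _ _ (`|g| ^+ 3 * (36 ^+ 2 * 54 * `|b'|))).
  by rewrite ler_pM ?exprn_ge0 // lerXn2r ?nnegrE.
have -> : `|g| ^+ 3 * (36 ^+ 2 * 54 * `|b'|) = 36 ^+ 2 * 54 * (`|g| ^+ 2 * `|be|).
  by rewrite hb normrM; ring.
rewrite ler_pM2l ?mulr_gt0 ?exprn_gt0 ?ltr0n // ler_wpM2r //.
by rewrite -(real_normK (num_real j)) lerXn2r ?nnegrE.
Qed.

(** * Size estimates *)

Section Estimates.
Variables (R : realType) (M xi x0 e1 e2 z0 f1 f2 X Z L L' : R).

Let x1 := x0 * xi + e1.
Let x2 := x0 * xi ^+ 3 + e2.
Let z1 := z0 * xi + f1.
Let z2 := z0 * xi ^+ 3 + f2.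
Let a := x0 ^+ 2 * x2 - x1 ^+ 3.
Let b := x0 ^+ 2 * z2 + 2 * x0 * x2 * z0 - 3 * x1 ^+ 2 * z1.
Let c := z0 ^+ 2 * x2 + 2 * z0 * z2 * x0 - 3 * z1 ^+ 2 * x1.
Let d := z0 ^+ 2 * z2 - z1 ^+ 3.
Let K := 4 * a * c - b ^+ 2.
Let v := x0 * f1 - z0 * e1.
(* The first coordinate of [2 a z - b x], a vector much shorter than [x] and [z]. *)
Let w := 2 * a * z0 - b * x0.
Let de := e2 - 3 * xi ^+ 2 * e1.
Let df := f2 - 3 * xi ^+ 2 * f1.

Hypotheses (M1 : 1 <= M) (xiM : `|xi| <= M).
Hypotheses (hX : `|x0| = X) (hZ : `|z0| = Z).
Hypotheses (X1 : 1 <= X) (Z1 : 1 <= Z) (L1 : L <= 1) (L'1 : L' <= 1).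
Hypotheses (he1 : `|e1| <= L) (he2 : `|e2| <= L).
Hypotheses (hf1 : `|f1| <= L') (hf2 : `|f2| <= L').
(** z approximates so much better than x that a term of size X^3 L' is dominated by the second-order
    error X Z L^2. *)
Hypothesis XL' : X ^+ 2 * L' <= Z * L ^+ 2.

Let X0 : 0 <= X. Proof. exact: le_trans X1. Qed.
Let Z0 : 0 <= Z. Proof. exact: le_trans Z1. Qed.
Let M0 : 0 <= M. Proof. exact: le_trans M1. Qed.
Let L0 : 0 <= L. Proof. exact: le_trans he1. Qed.
Let L'0 : 0 <= L'. Proof. exact: le_trans hf1. Qed.

Let bM (s t S T : R) : `|s| <= S -> `|t| <= T -> `|s * t| <= S * T.
Proof. by move=> hs ht; rewrite normrM ler_pM. Qed.
Let bD (s t S T : R) : `|s| <= S -> `|t| <= T -> `|s + t| <= S + T.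
Proof. by move=> hs ht; rewrite (le_trans (ler_normD _ _)) // lerD. Qed.
Let bN (s S : R) : `|s| <= S -> `|- s| <= S.
Proof. by rewrite normrN. Qed.
Let bX (s S : R) n : `|s| <= S -> `|s ^+ n| <= S ^+ n.
Proof. by move=> hs; rewrite normrX lerXn2r // nnegrE (le_trans _ hs). Qed.
Let bn n : `|n%:R : R| <= n%:R. Proof. by rewrite normr_nat. Qed.
Let bx0 : `|x0| <= X. Proof. by rewrite hX. Qed.
Let bz0 : `|z0| <= Z. Proof. by rewrite hZ. Qed.

Tactic Notation "bnd_with" tactic(tac) := repeat first [ tac | eassumption
  | exact: bn | exact: bx0 | exact: bz0 | apply: bX | apply: bN | apply: bD | apply: bM ].
Ltac bnd := bnd_with fail.

Let LX : L <= X. Proof. exact: le_trans X1. Qed.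

Lemma XL'_le : X * L' <= Z * L.
Proof.
have Xp : 0 < X by exact: lt_le_trans X1.
rewrite -(ler_pM2l Xp); have := ler_wpM2l (mulr_ge0 Z0 L0) LX; move: XL'; lra.
Qed.

Let MM : M <= M ^+ 2. Proof. by rewrite expr2 ler_peMr. Qed.
Let M21 : 1 <= M ^+ 2. Proof. exact: le_trans MM. Qed.

Lemma norm_de_le : `|de| <= 4 * M ^+ 2 * L.
Proof.
have h : `|de| <= L + 3 * M ^+ 2 * L by rewrite /de; bnd.
apply: le_trans h _; have := ler_wpM2r L0 M21; lra.
Qed.

Lemma norm_df_le : `|df| <= 4 * M ^+ 2 * L'.
Proof.
have h : `|df| <= L' + 3 * M ^+ 2 * L' by rewrite /df; bnd.
apply: le_trans h _; have := ler_wpM2r L'0 M21; lra.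
Qed.
(** Taylor expansion at y0 (1, xi, xi^3), a point of the curve: there is no constant term, and [de],
    [df] are the linear terms divided by the square of the first coordinate. *)
Lemma cubicE (y0 g1 g2 : R) :
  y0 ^+ 2 * (y0 * xi ^+ 3 + g2) - (y0 * xi + g1) ^+ 3 =
  y0 ^+ 2 * (g2 - 3 * xi ^+ 2 * g1) - 3 * xi * y0 * g1 ^+ 2 - g1 ^+ 3.
Proof. ring. Qed.

Lemma norm_a_le : `|a| <= 8 * M ^+ 2 * (X ^+ 2 * L).
Proof.
have h : `|a| <= X ^+ 2 * (4 * M ^+ 2 * L) + 3 * M * X * L ^+ 2 + L ^+ 3.
  by rewrite /a /x1 /x2 cubicE; bnd; exact: norm_de_le.
apply: le_trans h _.
have h1 : L ^+ 3 <= X ^+ 2 * L by rewrite exprSr ler_wpM2r // lerXn2r ?nnegrE.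
have h2 : X * L ^+ 2 <= X ^+ 2 * L by have := ler_wpM2l (mulr_ge0 X0 L0) LX; lra.
have T0 : 0 <= X ^+ 2 * L by rewrite mulr_ge0 // exprn_ge0.
have h3 : M * (X * L ^+ 2) <= M ^+ 2 * (X ^+ 2 * L) by rewrite ler_pM // mulr_ge0 // exprn_ge0.
have h4 := ler_wpM2r T0 M21.
lra.
Qed.

Lemma norm_d_le : `|d| <= 8 * M ^+ 2 * (Z ^+ 2 * L').
Proof.
have h : `|d| <= Z ^+ 2 * (4 * M ^+ 2 * L') + 3 * M * Z * L' ^+ 2 + L' ^+ 3.
  by rewrite /d /z1 /z2 cubicE; bnd; exact: norm_df_le.
apply: le_trans h _.
have LZ : L' <= Z by exact: le_trans Z1.
have h1 : L' ^+ 3 <= Z ^+ 2 * L' by rewrite exprSr ler_wpM2r // lerXn2r ?nnegrE.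
have h2 : Z * L' ^+ 2 <= Z ^+ 2 * L' by have := ler_wpM2l (mulr_ge0 Z0 L'0) LZ; lra.
have T0 : 0 <= Z ^+ 2 * L' by rewrite mulr_ge0 // exprn_ge0.
have h3 : M * (Z * L' ^+ 2) <= M ^+ 2 * (Z ^+ 2 * L') by rewrite ler_pM // mulr_ge0 // exprn_ge0.
have h4 := ler_wpM2r T0 M21.
lra.
Qed.

Lemma norm_v_le : `|v| <= 2 * (Z * L).
Proof.
have h : `|v| <= X * L' + Z * L by rewrite /v; bnd.
have := XL'_le; lra.
Qed.

Let W := X * Z * L ^+ 2.
Let W0 : 0 <= W. Proof. by rewrite /W !mulr_ge0. Qed.

Lemma norm_w_le : `|w| <= 18 * M ^+ 2 * W.
Proof.
(* The terms linear in the errors of x cancel between 2 a z0 and b x0; the linear term in the errors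
   of z that survives is controlled by [XL']. *)
have wE : w = - (x0 ^+ 3 * df + 3 * xi * x0 * z0 * e1 ^+ 2 + 2 * z0 * e1 ^+ 3
  - 6 * xi * x0 ^+ 2 * e1 * f1 - 3 * x0 * e1 ^+ 2 * f1).
  by rewrite /w /a /b /x1 /x2 /z1 /z2 /df; ring.
have h : `|w| <= X ^+ 3 * (4 * M ^+ 2 * L') + 3 * M * X * Z * L ^+ 2
    + 2 * Z * L ^+ 3 + 6 * M * X ^+ 2 * L * L' + 3 * X * L ^+ 2 * L'.
  by rewrite wE; bnd; exact: norm_df_le.
apply: le_trans h _.
have ZL0 : 0 <= Z * L by rewrite mulr_ge0.
have ZL20 : 0 <= Z * L ^+ 2 by rewrite mulr_ge0 // exprn_ge0.
have LL0 : 0 <= L ^+ 2 by rewrite exprn_ge0.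
have h1 : X ^+ 3 * L' <= W.
  by rewrite exprS -mulrA /W -mulrA ler_wpM2l.
have h2 : Z * L ^+ 3 <= W.
  by have := ler_wpM2l ZL20 LX; rewrite /W; lra.
have h3 : X ^+ 2 * L * L' <= W.
  apply: le_trans h1; have := ler_wpM2l (mulr_ge0 (exprn_ge0 2 X0) L'0) LX; lra.
have h4 : X * L ^+ 2 * L' <= W.
  apply: le_trans h3.
  have := ler_wpM2l (mulr_ge0 (mulr_ge0 X0 L0) L'0) LX; lra.
have g1 := ler_wpM2l (exprn_ge0 2 M0) h1.
have g2 := le_trans h2 (ler_peMl W0 M21).
have g3 : M * (X ^+ 2 * L * L') <= M ^+ 2 * W.
  by apply: ler_pM => //; rewrite !mulr_ge0 // exprn_ge0.
have g4 := le_trans h4 (ler_peMl W0 M21).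
have g5 := ler_wpM2r W0 MM.
rewrite /W in g1 g2 g3 g4 g5 *; lra.
Qed.
(** The vector z0 x - x0 z has first coordinate 0, so the partial derivative 3 a z0^2 - 2 b x0 z0 +
    c x0^2 of the restricted cubic reduces there to this monomial. Consequently t - z0 w = a z0^2 -
    b x0 z0 + c x0^2. *)
Let t := - 3 * v ^+ 2 * x1.

Lemma norm_t_le : `|t| <= 24 * M * (X * Z ^+ 2 * L ^+ 2).
Proof.
have h : `|t| <= 3 * (2 * (Z * L)) ^+ 2 * (X * M + L).
  by rewrite /t mulNr; bnd; exact: norm_v_le.
apply: le_trans h _.
have h1 : L <= X * M by rewrite (le_trans LX) // ler_peMr.
have h2 := ler_wpM2l (sqr_ge0 (Z * L)) h1; lra.
Qed.

Let U := Z ^+ 2 * L ^+ 3 + X ^+ 3 * Z * L'.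

Lemma norm_t_sub_le : `|t - z0 * w| <= 10 * M ^+ 2 * U.
Proof.
have tE : t - z0 * w = - (z0 ^+ 2 * e1 ^+ 3) + x0 ^+ 3 * z0 * df
  + 3 * x0 * z0 * e1 ^+ 2 * f1 - 3 * xi * x0 ^+ 3 * f1 ^+ 2
  - 3 * x0 ^+ 2 * e1 * f1 ^+ 2.
  by rewrite /t /v /w /a /b /x1 /x2 /z1 /z2 /df; ring.
have h : `|t - z0 * w| <= Z ^+ 2 * L ^+ 3 + X ^+ 3 * Z * (4 * M ^+ 2 * L')
    + 3 * X * Z * L ^+ 2 * L' + 3 * M * X ^+ 3 * L' ^+ 2
    + 3 * X ^+ 2 * L * L' ^+ 2.
  by rewrite tE; bnd; exact: norm_df_le.
apply: le_trans h _; have xl := XL'_le.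
have ZL20 : 0 <= Z * L ^+ 2 by rewrite mulr_ge0 // exprn_ge0.
have h1 := ler_wpM2l ZL20 xl.
have X2L'0 : 0 <= X ^+ 2 * L' by rewrite mulr_ge0 // exprn_ge0.
have X2ZL'0 : 0 <= X ^+ 2 * Z * L' by rewrite !mulr_ge0 // exprn_ge0.
have h2 := ler_wpM2l X2L'0 xl; have h3 := ler_wpM2l X2ZL'0 LX.
have h4 : X ^+ 2 * L * L' ^+ 2 <= X ^+ 3 * L' ^+ 2.
  by have := ler_wpM2l (mulr_ge0 X2L'0 L'0) LX; lra.
have U1 : 0 <= Z ^+ 2 * L ^+ 3 by rewrite mulr_ge0 // exprn_ge0.
have U2 : 0 <= X ^+ 3 * Z * L' by rewrite !mulr_ge0 // exprn_ge0.
have U3 : X ^+ 3 * L' ^+ 2 <= X ^+ 3 * Z * L' by lra.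
have g1 := ler_peMl U1 M21; have g2 := ler_peMl U2 M21.
have X30 : 0 <= X ^+ 3 * L' ^+ 2 by rewrite mulr_ge0 // exprn_ge0.
have g3 : M * (X ^+ 3 * L' ^+ 2) <= M ^+ 2 * (X ^+ 3 * Z * L') by rewrite ler_pM.
rewrite /U; lra.
Qed.

Lemma norm_K_le : `|K| <= 10 ^+ 3 * M ^+ 4 * (Z ^+ 2 * L ^+ 4 + X ^+ 3 * Z * L * L').
Proof.
have X2p : 0 < X ^+ 2 by rewrite exprn_gt0 // (lt_le_trans ltr01).
rewrite -(ler_pM2r X2p) -[X in `|_| * X ^+ 2]hX -normrX -normrM.
(* Completing the square in a z0^2 - b x0 z0 + c x0^2 exhibits a cancellation that 4 a c - b^2
   hides. *)
have -> : K * x0 ^+ 2 = 4 * a * (t - z0 * w) - w ^+ 2.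
  by rewrite /K /c /t /v /w /a /b /x1 /x2 /z1 /z2; ring.
have h : `|4 * a * (t - z0 * w) - w ^+ 2| <=
    4 * (8 * M ^+ 2 * (X ^+ 2 * L)) * (10 * M ^+ 2 * U) + (18 * M ^+ 2 * W) ^+ 2.
  by bnd; [exact: norm_a_le | exact: norm_t_sub_le | exact: norm_w_le].
apply: le_trans h _.
have g : 0 <= M ^+ 4 * (X ^+ 2 * (Z ^+ 2 * L ^+ 4)) by rewrite !mulr_ge0 // exprn_ge0.
have g2 : 0 <= M ^+ 4 * (X ^+ 2 * (X ^+ 3 * Z * L * L')).
  by rewrite !mulr_ge0 // exprn_ge0.
rewrite /U /W; lra.
Qed.

Lemma norm_b_le : `|b| <= 40 * M ^+ 2 * (X * Z * L).
Proof.
have Xp : 0 < X by exact: lt_le_trans X1.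
rewrite -(ler_pM2r Xp) -[X in `|_| * X]hX -normrM.
have -> : b * x0 = 2 * a * z0 - w by rewrite /w; ring.
have h : `|2 * a * z0 - w| <= 2 * (8 * M ^+ 2 * (X ^+ 2 * L)) * Z + 18 * M ^+ 2 * W.
  by bnd; [exact: norm_a_le | exact: norm_w_le].
apply: le_trans h _.
have h1 := ler_wpM2l (mulr_ge0 (mulr_ge0 (mulr_ge0 X0 Z0) L0) (exprn_ge0 2 M0)) LX.
have h2 : 0 <= M ^+ 2 * (X ^+ 2 * Z * L) by rewrite !mulr_ge0 // exprn_ge0.
rewrite /W; lra.
Qed.

Lemma norm_b_ge : 1 <= `|a| -> 18 * M ^+ 2 * (X * L ^+ 2) <= 1 -> Z <= `|b| * X.
Proof.
move=> a1 XL2; rewrite -[X in `|_| * X]hX -normrM.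
have -> : b * x0 = 2 * a * z0 - w by rewrite /w; ring.
have h1 : 2 * Z <= `|2 * a * z0|.
  by rewrite !normrM normr_nat hZ ler_wpM2r // ler_peMr.
have h2 := lerB_dist (2 * a * z0) w; have h3 := norm_w_le.
have h4 := ler_wpM2r Z0 XL2; rewrite /W in h3; lra.
Qed.

(** Multiplied by a, the left-hand quantity is the cubic at the short vector 2 a z - b x. It bounds
    D when K = 0. The identity below eliminates d, since the restricted cubic takes the value v^3 at
    (z0, - x0). *)
Lemma norm_G_le :
  `|8 * (a ^+ 2 * d) - b * K| <= 10 ^+ 5 * M ^+ 6 * (X * Z ^+ 3 * L ^+ 5).
Proof.
have X3p : 0 < X ^+ 3 by rewrite exprn_gt0 // (lt_le_trans ltr01).
rewrite -(ler_pM2r X3p) -[X in `|_| * X ^+ 3]hX -normrX -normrM.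
have -> : (8 * (a ^+ 2 * d) - b * K) * x0 ^+ 3 =
  - w ^+ 3 - 2 * a * z0 * w ^+ 2 + 4 * a * t * w - 8 * a ^+ 2 * v ^+ 3.
  by rewrite /K /c /d /t /v /w /a /b /x1 /x2 /z1 /z2; ring.
have h : `|- w ^+ 3 - 2 * a * z0 * w ^+ 2 + 4 * a * t * w - 8 * a ^+ 2 * v ^+ 3| <=
    (18 * M ^+ 2 * W) ^+ 3
    + 2 * (8 * M ^+ 2 * (X ^+ 2 * L)) * Z * (18 * M ^+ 2 * W) ^+ 2
    + 4 * (8 * M ^+ 2 * (X ^+ 2 * L)) * (24 * M * (X * Z ^+ 2 * L ^+ 2)) * (18 * M ^+ 2 * W)
    + 8 * (8 * M ^+ 2 * (X ^+ 2 * L)) ^+ 2 * (2 * (Z * L)) ^+ 3.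
  by bnd_with (first [ exact: norm_t_le | exact: norm_w_le | exact: norm_a_le
    | exact: norm_v_le ]).
apply: le_trans h _.
set T := X ^+ 4 * Z ^+ 3 * L ^+ 5.
have T0 : 0 <= T by rewrite /T !mulr_ge0 // exprn_ge0.
have MT k : (k <= 6)%N -> M ^+ k * T <= M ^+ 6 * T.
  by move=> k6; rewrite ler_wpM2r // ler_weXn2l.
have h1 : M ^+ 6 * (X ^+ 3 * Z ^+ 3 * L ^+ 6) <= M ^+ 6 * T.
  rewrite ler_wpM2l ?exprn_ge0 //.
  have XZL0 : 0 <= X ^+ 3 * Z ^+ 3 * L ^+ 5 by rewrite !mulr_ge0 // exprn_ge0.
  by have := ler_wpM2l XZL0 LX; rewrite /T; lra.
have h4 := MT 4%N isT; have h5 := MT 5%N isT; have h6 := MT 6%N isT.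
have M60 : 0 <= M ^+ 6 * T by rewrite mulr_ge0 // exprn_ge0.
rewrite /W; rewrite /T in h1 h4 h5 M60; lra.
Qed.
End Estimates.

(** * Logarithmic bounds for a pair of points *)

Definition height (v : vec) : nat :=
  maxn `|v.1.1|%N (maxn `|v.1.2|%N `|v.2|%N).

Definition apx (R : realType) (xi : R) (v : vec) : R :=
  Num.max `|v.1.2%:~R - v.1.1%:~R * xi| `|v.2%:~R - v.1.1%:~R * xi ^+ 3|.

Lemma height_ge (v : vec) :
  [/\ `|v.1.1| <= height v, `|v.1.2| <= height v & `|v.2| <= height v].
Proof. by rewrite /height -!abszE !lez_nat; split; lia. Qed.

Lemma height_cases (v : vec) :
  [\/ height v = `|v.1.1| :> int, height v = `|v.1.2| :> int | height v = `|v.2| :> int].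
Proof.
rewrite /height -!abszE.
case: (leqP `|v.1.1|%N (maxn `|v.1.2|%N `|v.2|%N)) => h; last by constructor 1; lia.
case: (leqP `|v.1.2|%N `|v.2|%N) => h'; [constructor 3 | constructor 2]; lia.
Qed.

Lemma apx_ge (R : realType) (xi : R) (v : vec) :
  `|v.1.2%:~R - v.1.1%:~R * xi| <= apx xi v /\
  `|v.2%:~R - v.1.1%:~R * xi ^+ 3| <= apx xi v.
Proof. by rewrite /apx !le_max !lexx !orbT. Qed.

Lemma norm_int_cast_ge1 (R : realType) (n : int) : n != 0 -> 1 <= `|n%:~R : R|.
Proof. by move=> n0; rewrite -intr_norm -[1]/(1%:~R) ler_int; lia. Qed.

Lemma norm_mul_le (R : realType) (s t S T : R) :
  `|s| <= S -> `|t| <= T -> `|s * t| <= S * T.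
Proof. by move=> hs ht; rewrite normrM ler_pM. Qed.

(* [u], [t] and [h] are the logarithms of [|x_0|], [|z_0|] and of the height of
   the normal form, [- s] and [- s'] those of the approximation errors. *)
Record pair_bounds (R : realType) (c u t s s' h : R) (b K D n : int) : Prop :=
  PairBounds {
    pb_near : near_cube n b K D;
    pb_D0 : D != 0;
    pb_n : expR (t - s - h - c) <= `|n%:~R|;
    pb_b : `|b%:~R| <= expR (u + t - s + c);
    pb_b_ge : expR (t - u) <= `|b%:~R|;
    pb_K : `|K%:~R| <= expR (2 * t - 4 * s + c);
    pb_D : `|D%:~R| <= expR (4 * u - 2 * s + 2 * t - s' + c);
    pb_D_K0 : K = 0 -> `|D%:~R| <= expR (u + 3 * t - 5 * s + c) }.

Section Pair.
Variables (R : realType) (xi : R).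

Let M : R := 1 + `|xi|.
Let M1 : 1 <= M. Proof. by rewrite /M lerDl. Qed.
Let xiM : `|xi| <= M. Proof. by rewrite /M lerDr. Qed.
(** Large enough to dominate every factor of the preceding estimates, so that on the logarithmic
    scale one additive [pair_const] absorbs each of them. *)
Let C : R := 10 ^+ 5 * M ^+ 6.

Definition pair_const : R := ln C.

Let C_ge k l n : (k <= 6)%N -> n%:R <= (10 ^+ 5 : R) -> l = n%:R * M ^+ k -> l <= C.
Proof.
move=> k6 hn ->; rewrite /C ler_pM ?exprn_ge0 //; last by rewrite ler_weXn2l.
exact: le_trans M1.
Qed.

Let Cpos : 0 < C.
Proof.
by apply: lt_le_trans ltr01 _; apply: (@C_ge 0 _ 1); rewrite ?expr0 ?mulr1 //; lra.
Qed.

Let expC : expR pair_const = C. Proof. by rewrite /pair_const lnK. Qed.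

Lemma pair_const_ge0 : 0 <= pair_const.
Proof.
rewrite -ler_expR expR0 expC; apply: le_trans (C_ge (k := 0) _ _ (erefl (1%:R * M ^+ 0))).
- by rewrite expr0 mulr1.
- by [].
- by lra.
Qed.

Variables (x z P : vec) (n : int) (u t s s' h : R).

Let x0 : R := x.1.1%:~R.
Let z0 : R := z.1.1%:~R.
Let e1 : R := x.1.2%:~R - x0 * xi.
Let e2 : R := x.2%:~R - x0 * xi ^+ 3.
Let f1 : R := z.1.2%:~R - z0 * xi.
Let f2 : R := z.2%:~R - z0 * xi ^+ 3.

Hypotheses (hu : `|x0| = expR u) (ht : `|z0| = expR t).
Hypotheses (hs : apx xi x = expR (- s)) (hs' : apx xi z = expR (- s')).
Hypothesis hh : (height P)%:~R = expR h.
Hypothesis hn : cross x z = scale n P.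
Hypotheses (u0 : 0 <= u) (t0 : 0 <= t) (s0 : 0 <= s) (s'0 : 0 <= s').

Let X1 : 1 <= expR u. Proof. by rewrite -expR0 ler_expR. Qed.
Let Z1 : 1 <= expR t. Proof. by rewrite -expR0 ler_expR. Qed.
Let L1 : expR (- s) <= 1. Proof. by rewrite -expR0 ler_expR oppr_le0. Qed.
Let L'1 : expR (- s') <= 1. Proof. by rewrite -expR0 ler_expR oppr_le0. Qed.
Let he1 : `|e1| <= expR (- s). Proof. by rewrite -hs; case: (apx_ge xi x). Qed.
Let he2 : `|e2| <= expR (- s). Proof. by rewrite -hs; case: (apx_ge xi x). Qed.
Let hf1 : `|f1| <= expR (- s'). Proof. by rewrite -hs'; case: (apx_ge xi z). Qed.
Let hf2 : `|f2| <= expR (- s'). Proof. by rewrite -hs'; case: (apx_ge xi z). Qed.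

Let x1E : x.1.2%:~R = x0 * xi + e1. Proof. by rewrite /e1; ring. Qed.
Let x2E : x.2%:~R = x0 * xi ^+ 3 + e2. Proof. by rewrite /e2; ring. Qed.
Let z1E : z.1.2%:~R = z0 * xi + f1. Proof. by rewrite /f1; ring. Qed.
Let z2E : z.2%:~R = z0 * xi ^+ 3 + f2. Proof. by rewrite /f2; ring. Qed.

Let cubicR (v : vec) :
  (cubic v)%:~R = v.1.1%:~R ^+ 2 * v.2%:~R - v.1.2%:~R ^+ 3 :> R.
Proof. by rewrite /cubic !(rmorphB, rmorphM, rmorphXn). Qed.

Let polarR (v w : vec) : (polar v w)%:~R = v.1.1%:~R ^+ 2 * w.2%:~R
  + 2 * v.1.1%:~R * v.2%:~R * w.1.1%:~R - 3 * v.1.2%:~R ^+ 2 * w.1.2%:~R :> R.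
Proof. by rewrite /polar !(rmorphB, rmorphD, rmorphM, rmorphXn). Qed.

Lemma norm_cubic_le : `|(cubic x)%:~R : R| <= 8 * M ^+ 2 * expR (2 * u - s).
Proof.
rewrite cubicR x1E x2E.
apply: le_trans (norm_a_le M1 xiM hu X1 L1 he1 he2) _.
have M80 : 0 <= 8 * M ^+ 2 by rewrite mulr_ge0 // exprn_ge0 // (le_trans _ M1).
by rewrite -expRM_natl -expRD ler_wpM2l // ler_expR; lra.
Qed.

Lemma cubic_exponent : cubic x != 0 -> s <= 2 * u + pair_const.
Proof.
move=> a0; have h1 := le_trans (norm_int_cast_ge1 R a0) norm_cubic_le.
rewrite -subr_ge0 -ler_expR expR0 (_ : _ - s = 2 * u - s + pair_const); last by ring.
rewrite expRD expC mulrC (le_trans h1) // ler_wpM2r ?expR_ge0 //.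
by apply: (@C_ge 2 _ 8); rewrite //; lra.
Qed.

(** Since n is a non-zero integer, P is no larger than cross x z, which is << X L' + Z L. The last
    hypothesis makes the X L' part at most half of the height of P. *)
Lemma index_exponent : n != 0 -> 0 <= h ->
  u - s' + pair_const <= h -> h <= t - s + pair_const.
Proof.
move=> n0 h0 hus.
have Mge0 : 0 <= M by exact: le_trans M1.
have H : expR h <= 4 * M ^+ 3 * (expR (u - s') + expR (t - s)).
  have n1 := norm_int_cast_ge1 R n0.
  have X0 := expR_ge0 u; have Z0 := expR_ge0 t.
  have L0 := expR_ge0 (- s); have L'0 := expR_ge0 (- s').
  have M31 : 1 <= M ^+ 3 by rewrite -(expr1n _ 3%N) lerXn2r ?nnegrE.
  have M21 : M <= M ^+ 3 by rewrite -[leLHS]expr1 ler_weXn2l.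
  rewrite -hh; case: hn => h1 h2 h3.
  have pX : 0 <= expR u * expR (- s') by rewrite mulr_ge0.
  have pZ : 0 <= expR t * expR (- s) by rewrite mulr_ge0.
  have pX' := ler_wpM2r pX M31; have pZ' := ler_wpM2r pZ M31.
  have pXM := ler_wpM2r pX M21; have pZM := ler_wpM2r pZ M21.
  have hLL : expR (- s) * expR (- s') <= expR t * expR (- s).
    rewrite mulrC ler_wpM2r //; exact: le_trans L'1 Z1.
  have step (p : int) (q : R) : (n * p)%:~R = q :> R ->
      `|q| <= 4 * M ^+ 3 * (expR u * expR (- s') + expR t * expR (- s)) ->
      `|p%:~R : R| <= 4 * M ^+ 3 * (expR u * expR (- s') + expR t * expR (- s)).
    move=> <-; apply: le_trans.
    by rewrite rmorphM normrM ler_peMl.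
  have : [/\ `|P.1.1%:~R : R| <= 4 * M ^+ 3 * (expR u * expR (- s') + expR t * expR (- s)),
      `|P.1.2%:~R : R| <= 4 * M ^+ 3 * (expR u * expR (- s') + expR t * expR (- s))
    & `|P.2%:~R : R| <= 4 * M ^+ 3 * (expR u * expR (- s') + expR t * expR (- s))].
    split.
    - apply: (step _ ((x0 * xi + e1) * (z0 * xi ^+ 3 + f2)
          - (x0 * xi ^+ 3 + e2) * (z0 * xi + f1))).
        by rewrite -h1 rmorphB !rmorphM /= x1E x2E z1E z2E.
      have -> : (x0 * xi + e1) * (z0 * xi ^+ 3 + f2)
          - (x0 * xi ^+ 3 + e2) * (z0 * xi + f1) =
        xi * (x0 * f2 - z0 * e2) + xi ^+ 3 * (z0 * e1 - x0 * f1) + (e1 * f2 - e2 * f1).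
        by ring.
      have b1 : `|x0 * f2 - z0 * e2| <= expR u * expR (- s') + expR t * expR (- s).
        by rewrite (le_trans (ler_normB _ _)) // lerD // norm_mul_le ?hu ?ht.
      have b2 : `|z0 * e1 - x0 * f1| <= expR u * expR (- s') + expR t * expR (- s).
        by rewrite (le_trans (ler_normB _ _)) // addrC lerD // norm_mul_le ?hu ?ht.
      have b3 : `|e1 * f2 - e2 * f1| <= 2 * (expR (- s) * expR (- s')).
        by rewrite (le_trans (ler_normB _ _)) // mulr_natl mulr2n lerD // norm_mul_le.
      have xi3 : `|xi ^+ 3| <= M ^+ 3 by rewrite normrX lerXn2r ?nnegrE.
      have c1 := norm_mul_le xiM b1; have c2 := norm_mul_le xi3 b2.
      apply: le_trans (ler_normD _ _) _.
      have := ler_normD (xi * (x0 * f2 - z0 * e2)) (xi ^+ 3 * (z0 * e1 - x0 * f1)).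
      lra.
    - apply: (step _ ((x0 * xi ^+ 3 + e2) * z0 - x0 * (z0 * xi ^+ 3 + f2))).
        by rewrite -h2 rmorphB !rmorphM /= x2E z2E.
      have -> : (x0 * xi ^+ 3 + e2) * z0 - x0 * (z0 * xi ^+ 3 + f2) =
        z0 * e2 - x0 * f2 by ring.
      have : `|z0 * e2 - x0 * f2| <= expR u * expR (- s') + expR t * expR (- s).
        by rewrite (le_trans (ler_normB _ _)) // addrC lerD // norm_mul_le ?hu ?ht.
      lra.
    - apply: (step _ (x0 * (z0 * xi + f1) - (x0 * xi + e1) * z0)).
        by rewrite -h3 rmorphB !rmorphM /= x1E z1E.
      have -> : x0 * (z0 * xi + f1) - (x0 * xi + e1) * z0 = x0 * f1 - z0 * e1 by ring.
      have : `|x0 * f1 - z0 * e1| <= expR u * expR (- s') + expR t * expR (- s).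
        by rewrite (le_trans (ler_normB _ _)) // lerD // norm_mul_le ?hu ?ht.
      lra.
  rewrite -!expRD => -[p1 p2 p3].
  by case: (height_cases P) => ->; rewrite intr_norm.
have C8 : 8 * M ^+ 3 <= C by apply: (@C_ge 3 _ 8); rewrite //; lra.
have hx : C * expR (u - s') <= expR h by rewrite -expC -expRD ler_expR; move: hus; lra.
rewrite -ler_expR expRD expC mulrC.
have e1' := ler_wpM2r (expR_ge0 (u - s')) C8.
have e2' := ler_wpM2r (expR_ge0 (t - s)) C8.
lra.
Qed.

Lemma pair_boundsP : primitive x -> cubic x != 0 -> cubic z != 0 ->
  2 * u - s' <= t - 2 * s ->
  u - 2 * s + pair_const <= 0 -> 3 * u + t - s - s' + pair_const <= 0 ->
  pair_bounds pair_const u t s s' h (polar x z)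
    (4 * cubic x * polar z x - polar x z ^+ 2) (cubic x ^+ 2 * cubic z) n.
Proof.
move=> px a0 d0 h1 h2 h3.
have Mge0 : 0 <= M by exact: le_trans M1.
have XL' : expR u ^+ 2 * expR (- s') <= expR t * expR (- s) ^+ 2.
  by rewrite -!expRM_natl -!expRD ler_expR; lra.
have a1 := norm_int_cast_ge1 R a0.
have ha := norm_a_le M1 xiM hu X1 L1 he1 he2.
have hd := norm_d_le M1 xiM ht Z1 L'1 hf1 hf2.
have hb := norm_b_le M1 xiM hu ht X1 Z1 L1 he1 he2 hf1 hf2 XL'.
have hK := norm_K_le M1 xiM hu ht X1 Z1 L1 he1 he2 hf1 hf2 XL'.
have hG := norm_G_le M1 xiM hu ht X1 Z1 L1 he1 he2 hf1 hf2 XL'.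
have hbg := norm_b_ge (e2 := e2) M1 xiM hu ht X1 Z1 L1 he1 hf1 hf2 XL'.
rewrite -!x1E -!x2E -!z1E -!z2E -!cubicR -!polarR in ha hd hb hK hG hbg.
have C_exp l E E' : l <= C -> E <= E' -> l * expR E <= expR (E' + pair_const).
  move=> lC EE; rewrite expRD expC mulrC.
  apply: (@le_trans _ _ (expR E * C)); first by apply: ler_wpM2l; rewrite ?expR_ge0.
  by rewrite ler_wpM2r ?ler_expR ?(ltW Cpos).
have M21 : 1 <= M ^+ 2 by rewrite -(expr1n _ 2%N) lerXn2r ?nnegrE.
have C4 : 4 <= C.
  by apply: le_trans (C_ge (k := 0) _ _ (erefl (4%:R * M ^+ 0))); rewrite ?expr0 ?mulr1 //; lra.
split.
- exact: near_cube_polar hn.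
- by rewrite mulf_neq0 ?expf_neq0.
- have s2 : 2 * expR (- s) <= 1.
    rewrite -(@expr_le1 _ 2) // ?mulr_ge0 ?expR_ge0 //.
    rewrite exprMn -expRM_natl.
    have : C * expR (2%:R * - s) <= 1.
      by rewrite -expC -expRD -[leRHS]expR0 ler_expR; move: u0 h2; lra.
    have := ler_wpM2r (expR_ge0 (2%:R * - s)) C4; lra.
  have XL : expR (u - s') <= expR (t - s) / 2.
    apply: (@le_trans _ _ (expR (t - s) * expR (- s))).
      by rewrite -expRD ler_expR; move: u0 h1; lra.
    by have := ler_wpM2l (expR_ge0 (t - s)) s2; lra.
  have nv (p : int) (e f : R) : `|p| <= height P -> `|e| = expR (- s) ->
      `|f| <= expR (- s') -> `|n%:~R * p%:~R| = `|x0 * f - z0 * e| ->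
      expR (t - s) / 2 <= `|n%:~R : R| * expR h.
    move=> hp he hf hv; apply: (@le_trans _ _ `|x0 * f - z0 * e|); last first.
      by rewrite -hv normrM ler_wpM2l // -hh -intr_norm ler_int.
    rewrite distrC; apply: le_trans (lerB_dist _ _).
    have : `|x0 * f| <= expR (u - s').
      by rewrite expRD; apply: norm_mul_le; rewrite ?hu.
    have -> : `|z0 * e| = expR (t - s) by rewrite normrM ht he expRD.
    by move: XL; lra.
  (* In the coordinate where the maximum defining [apx xi x] is attained, |z0 e| equals exp (t - s),
     and x0 f takes away at most half of it. *)
  have : expR (t - s) / 2 <= `|n%:~R : R| * expR h.
    have [P0 P1 P2] := height_ge P; case: hn => _ h4 h5.
    move: hs; rewrite /apx /Num.max; case: ifP => _ he.
      apply: (nv _ _ _ P1 he hf2); rewrite -rmorphM -h4 rmorphB !rmorphM /= x2E z2E.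
      by rewrite -normrN; congr `|_|; rewrite /e2; ring.
    apply: (nv _ _ _ P2 he hf1); rewrite -rmorphM -h5 rmorphB !rmorphM /= x1E z1E.
    by congr `|_|; rewrite /e1; ring.
  move=> hnH; rewrite expRB [expR (_ - h)]expRB expC ler_pdivrMr // ler_pdivrMr ?expR_gt0 //.
  have := ler_wpM2l (mulr_ge0 (normr_ge0 (n%:~R : R)) (expR_ge0 h)) C4.
  have := mulr_ge0 (normr_ge0 (n%:~R : R)) (expR_ge0 h); move: hnH; lra.
- apply: le_trans hb _; rewrite -!expRD; apply: C_exp; last by lra.
  by apply: (@C_ge 2 _ 40); rewrite //; lra.
- rewrite expRB ler_pdivrMr ?expR_gt0 //; apply: hbg => //.
  have : 18 * M ^+ 2 <= C by apply: (@C_ge 2 _ 18); rewrite //; lra.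
  move=> C18; rewrite -expRM_natl -expRD.
  apply: le_trans (ler_wpM2r (expR_ge0 _) C18) _.
  by rewrite -expC -expRD -[leRHS]expR0 ler_expR; move: h2; lra.
- have [->|K0] := eqVneq (4 * cubic x * polar z x - polar x z ^+ 2) 0.
    by rewrite normr0 expR_ge0.
  have K1 := norm_int_cast_ge1 R K0.
  rewrite rmorphB rmorphXn !rmorphM /= in K1 *.
  (* The second term of [norm_K_le] is thus at most 1/2; as |K| >= 1 it is absorbed on the left, and
     the exponent 2 t - 4 s remains. *)
  have : 2 * 10 ^+ 3 * M ^+ 4 * expR (3 * u + t - s - s') <= 1.
    have : 2 * 10 ^+ 3 * M ^+ 4 <= C.
      rewrite (_ : 2 * 10 ^+ 3 = 2000%:R :> R); last by lra.
      by apply: (@C_ge 4 _ 2000); rewrite //; lra.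
    move=> C2; apply: le_trans (ler_wpM2r (expR_ge0 _) C2) _.
    by rewrite -expC -expRD -[leRHS]expR0 ler_expR; move: h3; lra.
  have : 2 * 10 ^+ 3 * M ^+ 4 * expR (2 * t - 4 * s) <= expR (2 * t - 4 * s + pair_const).
    apply: C_exp => //.
    rewrite (_ : 2 * 10 ^+ 3 = 2000%:R :> R); last by lra.
    by apply: (@C_ge 4 _ 2000); rewrite //; lra.
  move: hK; rewrite -!expRM_natl -!expRD.
  rewrite (_ : 2%:R * t + 4%:R * - s = 2 * t - 4 * s); last by ring.
  rewrite (_ : 3%:R * u + t + - s + - s' = 3 * u + t - s - s'); last by ring.
  move: K1; lra.
- rewrite rmorphM rmorphXn normrM normrX.
  apply: (@le_trans _ _ ((8 * M ^+ 2 * (expR u ^+ 2 * expR (- s))) ^+ 2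
      * (8 * M ^+ 2 * (expR t ^+ 2 * expR (- s'))))).
    by rewrite ler_pM ?exprn_ge0 // lerXn2r ?nnegrE // (le_trans _ ha).
  have -> : (8 * M ^+ 2 * (expR u ^+ 2 * expR (- s))) ^+ 2
      * (8 * M ^+ 2 * (expR t ^+ 2 * expR (- s'))) =
    512 * M ^+ 6 * (expR u ^+ 4 * expR (- s) ^+ 2 * expR t ^+ 2 * expR (- s')).
    by ring.
  rewrite -!expRM_natl -!expRD; apply: C_exp; last by lra.
  by apply: (@C_ge 6 _ 512); rewrite //; lra.
- move=> K0; move: hG.
  have -> : 8 * ((cubic x)%:~R ^+ 2 * (cubic z)%:~R) - (polar x z)%:~R
      * (4 * (cubic x)%:~R * (polar z x)%:~R - (polar x z)%:~R ^+ 2) =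
      8 * (cubic x ^+ 2 * cubic z)%:~R :> R.
    rewrite [(cubic x ^+ 2 * cubic z)%:~R]rmorphM rmorphXn /=.
    have -> : 4 * (cubic x)%:~R * (polar z x)%:~R - (polar x z)%:~R ^+ 2 = 0 :> R.
      move: (congr1 (fun m : int => m%:~R : R) K0).
      by rewrite rmorphB rmorphXn !rmorphM.
    by rewrite mulr0 subr0.
  rewrite normrM normr_nat -!expRM_natl -!expRD.
  have := @C_exp C (u + 3 * t - 5 * s) _ (lexx _) (lexx _).
  rewrite -/C (_ : u + 3%:R * t + 5%:R * - s = u + 3 * t - 5 * s); last by ring.
  have := normr_ge0 ((cubic x ^+ 2 * cubic z)%:~R : R); lra.
Qed.
End Pair.

(** * Excluded ranges of exponents *)

(** K = 0 makes n^2 divide b^2, hence n divides b, and every term of 108 D contains n^3. *)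
Lemma near_cube_K0 (n b D : int) : near_cube n b 0 D -> (n ^+ 3 %| 108 * D)%Z.
Proof.
case=> A [J [hK hD]].
have hb : b ^+ 2 = n ^+ 2 * (4 * A).
  by apply: subr0_eq; rewrite -[RHS](mulr0 3) hK; ring.
have : (n ^+ 2 %| b ^+ 2)%Z by rewrite hb dvdz_mulr.
rewrite dvdz_pexp2r // => /dvdzP[q hq].
apply/dvdzP; exists (q ^+ 3 + 4 * J).
have -> : 108 * D = 4 * (27 * D) by ring.
rewrite hD; transitivity (4 * b ^+ 3 - 3 * b * (n ^+ 2 * (4 * A)) + 4 * n ^+ 3 * J).
  by ring.
by rewrite -hb hq; ring.
Qed.

Lemma cube_eq_27square (K D : int) : K ^+ 3 = 27 * D ^+ 2 -> K != 0 ->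
  exists j, [/\ j != 0, K = 3 * j ^+ 2 & D = j ^+ 3].
Proof.
move=> hKD K0.
have : (3 ^+ 3 %| K ^+ 3)%Z by rewrite hKD; apply: dvdz_mulr.
rewrite dvdz_pexp2r // => /dvdzP[k hk].
have hk3 : k ^+ 3 = D ^+ 2.
  apply: (@mulfI _ 27) => //; rewrite -hKD hk; ring.
have : (k ^+ 2 %| D ^+ 2)%Z by rewrite -hk3; apply: dvdz_exp2l.
rewrite dvdz_pexp2r // => /dvdzP[j hj].
have k0 : k != 0 by apply: contraNneq K0; rewrite hk => ->.
have hkj : k = j ^+ 2.
  apply: (@mulfI _ (k ^+ 2)); first by rewrite expf_neq0.
  by rewrite -exprSr hk3 hj; ring.
exists j; split; last by rewrite hj hkj; ring.
- by apply: contraNneq k0; rewrite hkj => ->.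
- by rewrite hk hkj; ring.
Qed.

(** Eliminating A and J shows that n^2 divides b^2 - 3 K and n^3 divides b^3 + 9 b K - 108 D; for K
    = 3 j^2 and D = j^3 both have the factor b - 3 j. *)
Lemma near_cube_triple_le (n b j : int) : near_cube n b (3 * j ^+ 2) (j ^+ 3) ->
  j != 0 -> b - 3 * j != 0 ->
  `|n| ^+ 3 <= 36 ^+ 2 * 54 * (j ^+ 2 * `|b - 3 * j|).
Proof.
move=> [A [J [hK hD]]] j0 b0; apply: near_triple_root_le => //.
- apply/dvdzP; exists (4 * A).
  transitivity (b ^+ 2 - 3 * (3 * j ^+ 2)); first by ring.
  by rewrite hK; ring.
- apply/dvdzP; exists (- 4 * J).
  transitivity (b ^+ 3 + 9 * b * (3 * j ^+ 2) - 4 * (27 * j ^+ 3)); first by ring.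
  rewrite hD; transitivity (- (b ^+ 3) * 3 + 3 * b * (3 * (3 * j ^+ 2))
    + 12 * b * (n ^+ 2 * A) - 4 * n ^+ 3 * J); first by ring.
  by rewrite hK; ring.
Qed.

(** Integrality enters here: the relation makes K divide 135 D^2, so K is bounded in terms of D, and
    dividing the relation by K D then bounds b. *)
Lemma cubic_relation_le (R : realFieldType) (b K D : int) :
  K ^+ 3 - 18 * b * K * D + 135 * D ^+ 2 = 0 -> K != 0 -> D != 0 ->
  `|b%:~R : R| <= 10 ^+ 4 * `|D%:~R| ^+ 3.
Proof.
move=> hr K0 D0.
have KD : `|K%:~R : R| <= 135 * `|D%:~R| ^+ 2.
  have : (K %| 135 * D ^+ 2)%Z.
    apply/dvdzP; exists (18 * b * D - K ^+ 2).
    by apply: subr0_eq; rewrite -[RHS]hr; ring.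
  move/dvdz_norm_le; rewrite mulf_neq0 ?expf_neq0 // => /(_ isT).
  rewrite -(ler_int R) !intr_norm rmorphM rmorphXn normrM normrX /=.
  by rewrite normr_nat.
have D1 : 1 <= `|D%:~R : R| by rewrite -intr_norm -[1]/(1%:~R) ler_int; lia.
have K1 : 1 <= `|K%:~R : R| by rewrite -intr_norm -[1]/(1%:~R) ler_int; lia.
have e : 18 * `|b%:~R : R| * `|D%:~R| * `|K%:~R| = `|K%:~R ^+ 3 + 135 * D%:~R ^+ 2|.
  have -> : K%:~R ^+ 3 + 135 * D%:~R ^+ 2 = 18 * b%:~R * D%:~R * K%:~R :> R.
    apply: subr0_eq; transitivity ((K ^+ 3 - 18 * b * K * D + 135 * D ^+ 2)%:~R : R).
      by ring.
    by rewrite hr.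
  by rewrite !normrM normr_nat.
have := ler_normD (K%:~R ^+ 3 : R) (135 * D%:~R ^+ 2).
rewrite -e normrX normrM normr_nat normrX.
move: (`|b%:~R|) (`|D%:~R|) (`|K%:~R|) (normr_ge0 (b%:~R : R)) D1 K1 KD => B d k B0 d1 k1 kd.
have d0 : 0 <= d by exact: le_trans d1.
have k0 : 0 <= k by exact: le_trans k1.
rewrite (_ : 135 * d ^+ 2 = 135 * d ^+ 2 * 1) ?mulr1 // => h.
have h2 : 18 * B * d * k <= (k ^+ 2 + 135 * d ^+ 2) * k.
  apply: le_trans h _; have := ler_wpM2l (mulr_ge0 (ler0n R 135) (sqr_ge0 d)) k1; lra.
rewrite ler_pM2r in h2; last by exact: lt_le_trans k1.
have k2 : k ^+ 2 <= (135 * d ^+ 2) ^+ 2.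
  by rewrite lerXn2r ?nnegrE // (le_trans k0).
have d2 : d ^+ 2 <= d ^+ 4 by rewrite ler_weXn2l.
have : 18 * B * d <= 18 * (10 ^+ 4 * d ^+ 3) * d by nra.
rewrite ler_pM2r ?ler_pM2l //; exact: lt_le_trans d1.
Qed.

(** If K^2 exceeded 10^3 |b D|, the term b K^4 would outweigh all the others together; |K| <= |b|^2
    serves to compare the terms with fewer factors b. *)
Lemma p9_root_le (R : realFieldType) (b K D : R) :
  b * K ^+ 4 - 11 * b ^+ 2 * K ^+ 2 * D - b ^+ 3 * D ^+ 2
    - 10 * K ^+ 3 * D + 180 * b * K * D ^+ 2 - 675 * D ^+ 3 = 0 ->
  b != 0 -> `|K| <= `|b| ^+ 2 -> `|K| ^+ 2 <= 10 ^+ 3 * (`|b| * `|D|).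
Proof.
move=> hp b0 hKb; rewrite leNgt; apply/negP => hlt.
have e : `|b * K ^+ 4| = `|11 * b ^+ 2 * K ^+ 2 * D + b ^+ 3 * D ^+ 2
    + 10 * K ^+ 3 * D - 180 * b * K * D ^+ 2 + 675 * D ^+ 3|.
  by congr `|_|; apply: subr0_eq; rewrite -[RHS]hp; ring.
have : `|b| * `|K| ^+ 4 <= 11 * `|b| ^+ 2 * `|K| ^+ 2 * `|D| + `|b| ^+ 3 * `|D| ^+ 2
    + 10 * `|K| ^+ 3 * `|D| + 180 * `|b| * `|K| * `|D| ^+ 2 + 675 * `|D| ^+ 3.
  rewrite -normrX -normrM e.
  do 4 (apply: le_trans (ler_normD _ _) _; apply: lerD; last
    by rewrite ?normrN !(normrX, normrM) ?normr_nat).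
  by rewrite !(normrX, normrM) normr_nat.
have B0 : 0 < `|b| by rewrite normr_gt0.
move: (`|b|) (`|K|) (`|D|) (normr_ge0 K) (normr_ge0 D) B0 hKb hlt => B k d k0 d0 B0 kB hlt.
have Bd0 : 0 <= B * d by rewrite mulr_ge0 // ltW.
have kk0 : 0 <= k ^+ 4 by rewrite exprn_ge0.
have y1 : B * d <= k ^+ 2 / 10 ^+ 3 by lra.
have y2 : (B * d) ^+ 2 <= (k ^+ 2 / 10 ^+ 3) ^+ 2 by rewrite lerXn2r // nnegrE (le_trans Bd0).
have y3 : (B * d) ^+ 3 <= (k ^+ 2 / 10 ^+ 3) ^+ 3 by rewrite lerXn2r // nnegrE (le_trans Bd0).
have kB2 : k ^+ 2 <= B ^+ 4.
  by rewrite (_ : 4 = 2 * 2)%N // exprM lerXn2r // nnegrE exprn_ge0 // ltW.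
have t1 : B ^+ 2 * k ^+ 2 * d <= B * k ^+ 4 / 10 ^+ 3.
  by have := ler_wpM2l (mulr_ge0 (ltW B0) (sqr_ge0 k)) y1; lra.
have t2 : B ^+ 3 * d ^+ 2 <= B * k ^+ 4 / 10 ^+ 6.
  by have := ler_wpM2l (ltW B0) y2; lra.
have t3 : k ^+ 3 * d <= B * k ^+ 4 / 10 ^+ 3.
  rewrite -(ler_pM2l B0).
  have := ler_wpM2l (exprn_ge0 3 k0) y1; have := ler_wpM2l kk0 kB; lra.
have t4 : B * k * d ^+ 2 <= B * k ^+ 4 / 10 ^+ 6.
  rewrite -(ler_pM2l (exprn_gt0 2 B0)).
  have := ler_wpM2l (mulr_ge0 (ltW B0) k0) y2.
  have := ler_wpM2l (mulr_ge0 (ltW B0) kk0) kB; lra.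
have t5 : d ^+ 3 <= B * k ^+ 4 / 10 ^+ 9.
  rewrite -(ler_pM2l (exprn_gt0 3 B0)).
  have := ler_wpM2l kk0 kB2; lra.
have T0 : 0 <= B * k ^+ 4 by rewrite mulr_ge0 // ltW.
move=> hs; have k4 : B * k ^+ 4 <= B * 0 by lra.
rewrite ler_pM2l // in k4; have /eqP : k ^+ 4 = 0 by apply/le_anti/andP.
by rewrite expf_eq0 /= => /eqP k00; move: hlt; rewrite k00 expr0n /= ltNge mulr_ge0 ?exprn_ge0.
Qed.

Section Gaps.
Variables (R : realType) (c u t s s' h : R) (b K D n : int).
Hypothesis c0 : 0 <= c.
Hypothesis pb : pair_bounds c u t s s' h b K D n.

Let nu : R := t - s - h - c.
Let eD : R := 4 * u - 2 * s + 2 * t - s' + c.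
Let kap : R := ln (10 ^+ 6).
Let kapE : expR kap = 10 ^+ 6.
Proof. by rewrite /kap lnK // posrE exprn_gt0. Qed.
Let kap0 : 0 <= kap.
Proof. by rewrite -ler_expR expR0 kapE; lra. Qed.

Definition gap_const : R := 20 * c + 2 * ln (10 ^+ 6).

Let gcE : gap_const = 20 * c + 2 * kap. Proof. by []. Qed.

Let eX (a A : R) k : `|a| <= expR A -> `|a ^+ k| <= expR (k%:R * A).
Proof. by move=> ha; rewrite normrX expRM_natl lerXn2r // nnegrE expR_ge0. Qed.

Let eM (a A a' A' : R) : `|a| <= expR A -> `|a'| <= expR A' -> `|a * a'| <= expR (A + A').
Proof. by move=> ha ha'; rewrite expRD norm_mul_le. Qed.

Let eS (a A E : R) : `|a| <= expR A -> A + kap <= E -> 10 ^+ 6 * `|a| <= expR E.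
Proof.
move=> ha hE; rewrite -kapE mulrC; apply: le_trans (ler_wpM2r (expR_ge0 _) ha) _.
by rewrite -expRD ler_expR.
Qed.

Let dvd_eq0 (N p : int) k :
  (n ^+ k %| N * p)%Z -> 0 < N -> N%:~R * `|p%:~R| < expR (k%:R * nu) -> p = 0.
Proof.
move=> hd N0 hlt; have [//|p0] := eqVneq p 0; move: hlt; rewrite ltNge => /negP[].
have Np0 : N * p != 0 by rewrite mulf_neq0 // gt_eqF.
have := dvdz_norm_le hd Np0; rewrite !normrM (gtr0_norm N0) normrX.
rewrite -(ler_int R) rmorphXn rmorphM /= !intr_norm; apply: le_trans.
rewrite expRM_natl lerXn2r ?nnegrE ?expR_ge0 //; exact: pb_n pb.
Qed.

Lemma gap_K0 : K = 0 -> 2 * s <= u + 3 * h + gap_const.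
Proof.
move=> K0; have hd : (n ^+ 3 %| 108 * D)%Z.
  by apply: (@near_cube_K0 _ b); rewrite -K0; exact: pb_near pb.
rewrite leNgt; apply/negP => hlt.
have := pb_D0 pb; rewrite (dvd_eq0 hd) ?eqxx //.
have := eS (pb_D_K0 pb K0) (lexx _).
have : expR (u + 3 * t - 5 * s + c + kap) <= expR (3%:R * nu).
  by rewrite ler_expR /nu; move: hlt kap0 c0; rewrite gcE; lra.
have := expR_gt0 (3%:R * nu); have := normr_ge0 (D%:~R : R); lra.
Qed.

Hypothesis K0 : K != 0.

Lemma gap_K_neq0 : 2 * s <= t + gap_const.
Proof.
have := le_trans (norm_int_cast_ge1 R K0) (pb_K pb).
rewrite -[leLHS]expR0 ler_expR; move: kap0 c0; rewrite gcE; lra.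
Qed.

Hypothesis bK : u + gap_const < 2 * s.

Let eD0 : 0 <= eD.
Proof.
rewrite -ler_expR expR0; exact: le_trans (norm_int_cast_ge1 R (pb_D0 pb)) (pb_D pb).
Qed.

(** Vanishing of K^3 - 27 D^2 gives K = 3 j^2 and D = j^3. By [bK], j is negligible beside b, so b -
    3 j is non-zero and of the size of b; then n^3 << j^2 |b| contradicts the first hypothesis. *)
Lemma gap_order2 : u + 3 * h + gap_const < 2 * s ->
  6 * t - 12 * s + gap_const <= 2 * (t - s - h) ->
  eD + gap_const <= t - s - h -> False.
Proof.
move=> hs h1 h2; have hK := pb_K pb; have hD := pb_D pb; rewrite -/eD in hD.
have hKD : K ^+ 3 - 27 * D ^+ 2 = 0.
  apply: (dvd_eq0 (near_cube_dvd2 (pb_near pb))) => //.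
  have hK3 : 10 ^+ 6 * `|K%:~R ^+ 3 : R| <= expR (2%:R * nu).
    apply: eS (eX 3 hK) _; rewrite /nu; move: h1 kap0 c0; rewrite gcE; lra.
  have hD2 : 10 ^+ 6 * `|D%:~R ^+ 2 : R| <= expR (2%:R * nu).
    apply: eS (eX 2 hD) _; rewrite /nu; move: h2 kap0 c0; rewrite gcE; lra.
  have -> : (K ^+ 3 - 27 * D ^+ 2)%:~R = K%:~R ^+ 3 - 27 * D%:~R ^+ 2 :> R by ring.
  have := ler_normB (K%:~R ^+ 3 : R) (27 * D%:~R ^+ 2).
  rewrite [`|27 * _|]normrM normr_nat.
  move: (`|_ - _|) (`|K%:~R ^+ 3|) (`|D%:~R ^+ 2|) hK3 hD2 => p q r hK3 hD2 hp.
  have := expR_gt0 (2%:R * nu); rewrite (_ : 27%:~R = 27%:R :> R) //; lra.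
have [j [j0 Kj Dj]] := cube_eq_27square (subr0_eq hKD) K0.
have jK : `|j%:~R : R| ^+ 2 <= expR (2 * t - 4 * s + c).
  apply: le_trans hK; rewrite Kj -normrX.
  rewrite (_ : (3 * j ^+ 2)%:~R = 3 * j%:~R ^+ 2 :> R); last by ring.
  by rewrite [`|3 * _|]normrM normr_nat; have := normr_ge0 (j%:~R ^+ 2 : R); lra.
have jle : `|j%:~R : R| <= expR (t - 2 * s + c / 2).
  rewrite -(@ler_pXn2r _ 2) ?nnegrE ?expR_ge0 // -expRM_natl; apply: le_trans jK _.
  by rewrite ler_expR; lra.
have jb : 10 ^+ 6 * `|j%:~R : R| <= `|b%:~R|.
  apply: le_trans (pb_b_ge pb); apply: eS jle _; move: bK kap0 c0; rewrite gcE; lra.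
have j1 := norm_int_cast_ge1 R j0.
have hbe : `|(b - 3 * j)%:~R : R| <= 2 * `|b%:~R|.
  rewrite (_ : (b - 3 * j)%:~R = b%:~R - 3 * j%:~R :> R); last by ring.
  apply: le_trans (ler_normB _ _) _; rewrite [`|3 * _|]normrM normr_nat.
  by have := normr_ge0 (j%:~R : R); lra.
have be0 : b - 3 * j != 0.
  apply/eqP => /subr0_eq be; move: jb; rewrite be.
  rewrite (_ : (3 * j)%:~R = 3 * j%:~R :> R); last by ring.
  by rewrite [`|3 * _|]normrM normr_nat; lra.
have := pb_near pb; rewrite Kj Dj => hnc.
have hn3 : `|n%:~R : R| ^+ 3 <= 36 ^+ 2 * 54 * (j%:~R ^+ 2 * `|(b - 3 * j)%:~R|).
  rewrite -!intr_norm -rmorphXn (_ : 36 ^+ 2 * 54 * (j%:~R ^+ 2 * `|b - 3 * j|%:~R) =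
    (36 ^+ 2 * 54 * (j ^+ 2 * `|b - 3 * j|))%:~R); last by ring.
  by rewrite ler_int; exact: near_cube_triple_le hnc j0 be0.
have hn3' : expR (3%:R * nu) <=
    36 ^+ 2 * 54 * (expR (2 * t - 4 * s + c) * (2 * expR (u + t - s + c))).
  rewrite expRM_natl; apply: (@le_trans _ _ (`|n%:~R : R| ^+ 3)).
    by rewrite lerXn2r ?nnegrE ?expR_ge0 //; exact: pb_n pb.
  apply: le_trans hn3 _; rewrite ler_wpM2l ?mulr_ge0 ?exprn_ge0 // ler_pM ?sqr_ge0 //.
    by move: jK; rewrite -normrX ger0_norm ?sqr_ge0.
  by apply: le_trans hbe _; rewrite ler_wpM2l //; exact: pb_b pb.
have : 10 ^+ 6 * expR (2 * t - 4 * s + c + (u + t - s + c)) <= expR (3%:R * nu).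
  by rewrite -kapE -expRD ler_expR /nu; move: hs kap0 c0; rewrite gcE; lra.
move: hn3'; rewrite (mulrCA (expR _)) -expRD.
by have := expR_gt0 (2 * t - 4 * s + c + (u + t - s + c)); lra.
Qed.

Let eP : R := u + t - s + c.
Let eK : R := 2 * t - 4 * s + c.

(** Vanishing of the second integer gives |b| << |D|^3, against the lower bound exp (t - u) for |b|.
    In the second alternative K^3 is not known to be small; vanishing of the third integer gives
    |K|^3 << |b K D|, which is. *)
Lemma gap_order36 :
  eP + eK + eD + gap_const <= 3 * nu -> 2 * eD + gap_const <= 3 * nu ->
  3 * eD + gap_const <= t - u ->
  3 * eK + gap_const <= 3 * nu \/
  [/\ eP + 4 * eK + gap_const <= 6 * nu,
      2 * eP + 2 * eK + eD + gap_const <= 6 * nu,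
      3 * eP + 2 * eD + gap_const <= 6 * nu,
      3 * eK + eD + gap_const <= 6 * nu
    & eP + eK + 2 * eD + gap_const <= 6 * nu] -> False.
Proof.
move=> h1 h2 h3 hor; have hK := pb_K pb; have hD := pb_D pb; have hb := pb_b pb.
rewrite -/eD -/eP -/eK in hK hD hb.
have hbKD : 10 ^+ 6 * `|b%:~R * K%:~R * D%:~R : R| <= expR (3%:R * nu).
  apply: eS (eM (eM hb hK) hD) _; move: h1 kap0 c0; rewrite gcE; lra.
have hD2 : 10 ^+ 6 * `|D%:~R ^+ 2 : R| <= expR (3%:R * nu).
  apply: eS (eX 2 hD) _; move: h2 kap0 c0; rewrite gcE; lra.
suff hK3 : 10 ^+ 3 * `|K%:~R ^+ 3 : R| <= expR (3%:R * nu).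
  have hr : K ^+ 3 - 18 * b * K * D + 135 * D ^+ 2 = 0.
    apply: (dvd_eq0 (near_cube_dvd3 (pb_near pb))) => //.
    have -> : (K ^+ 3 - 18 * b * K * D + 135 * D ^+ 2)%:~R =
      K%:~R ^+ 3 - 18 * (b%:~R * K%:~R * D%:~R) + 135 * D%:~R ^+ 2 :> R by ring.
    move: hbKD hD2 hK3; set p := K%:~R ^+ 3; set q := b%:~R * _ * _; set r := D%:~R ^+ 2.
    have := ler_normB p (18 * q); have := ler_normD (p - 18 * q) (135 * r).
    rewrite [`|18 * _|]normrM [`|135 * _|]normrM !normr_nat.
    have := expR_gt0 (3%:R * nu); rewrite (_ : 27%:~R = 27%:R :> R) //.
    have := normr_ge0 q; have := normr_ge0 r; have := normr_ge0 p; lra.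
  have hle := @cubic_relation_le R _ _ _ hr K0 (pb_D0 pb).
  have h4 : 10 ^+ 6 * `|D%:~R ^+ 3 : R| <= expR (t - u).
    apply: eS (eX 3 hD) _; move: h3 kap0 c0; rewrite gcE; lra.
  have := pb_b_ge pb; move: hle h4; rewrite -normrX.
  by have := expR_gt0 (t - u); lra.
case: hor => [hK3|[g1 g2 g3 g4 g5]].
  have : 10 ^+ 6 * `|K%:~R ^+ 3 : R| <= expR (3%:R * nu).
    apply: eS (eX 3 hK) _; move: hK3 kap0 c0; rewrite gcE; lra.
  have := normr_ge0 (K%:~R ^+ 3 : R); lra.
have hbK4 : 10 ^+ 6 * `|b%:~R * K%:~R ^+ 4 : R| <= expR (6%:R * nu).
  apply: eS (eM hb (eX 4 hK)) _; move: g1 kap0 c0; rewrite gcE; lra.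
have hb2K2D : 10 ^+ 6 * `|b%:~R ^+ 2 * K%:~R ^+ 2 * D%:~R : R| <= expR (6%:R * nu).
  apply: eS (eM (eM (eX 2 hb) (eX 2 hK)) hD) _; move: g2 kap0 c0; rewrite gcE; lra.
have hb3D2 : 10 ^+ 6 * `|b%:~R ^+ 3 * D%:~R ^+ 2 : R| <= expR (6%:R * nu).
  apply: eS (eM (eX 3 hb) (eX 2 hD)) _; move: g3 kap0 c0; rewrite gcE; lra.
have hK3D : 10 ^+ 6 * `|K%:~R ^+ 3 * D%:~R : R| <= expR (6%:R * nu).
  apply: eS (eM (eX 3 hK) hD) _; move: g4 kap0 c0; rewrite gcE; lra.
have hbKD2 : 10 ^+ 6 * `|b%:~R * K%:~R * D%:~R ^+ 2 : R| <= expR (6%:R * nu).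
  apply: eS (eM (eM hb hK) (eX 2 hD)) _; move: g5 kap0 c0; rewrite gcE; lra.
have hD3 : 10 ^+ 6 * `|D%:~R ^+ 3 : R| <= expR (6%:R * nu).
  apply: eS (eX 3 hD) _; move: h2 kap0 c0 eD0; rewrite gcE; lra.
have hp9 : b%:~R * K%:~R ^+ 4 - 11 * b%:~R ^+ 2 * K%:~R ^+ 2 * D%:~R
    - b%:~R ^+ 3 * D%:~R ^+ 2 - 10 * K%:~R ^+ 3 * D%:~R
    + 180 * b%:~R * K%:~R * D%:~R ^+ 2 - 675 * D%:~R ^+ 3 = 0 :> R.
  transitivity ((b * K ^+ 4 - 11 * b ^+ 2 * K ^+ 2 * D - b ^+ 3 * D ^+ 2
    - 10 * K ^+ 3 * D + 180 * b * K * D ^+ 2 - 675 * D ^+ 3)%:~R : R); first by ring.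
  apply/eqP; rewrite intr_eq0; apply/eqP.
  apply: (dvd_eq0 (near_cube_dvd6 (pb_near pb))); first by rewrite ltr0n.
  have -> : (b * K ^+ 4 - 11 * b ^+ 2 * K ^+ 2 * D - b ^+ 3 * D ^+ 2
    - 10 * K ^+ 3 * D + 180 * b * K * D ^+ 2 - 675 * D ^+ 3)%:~R =
    b%:~R * K%:~R ^+ 4 - 11 * (b%:~R ^+ 2 * K%:~R ^+ 2 * D%:~R)
    - b%:~R ^+ 3 * D%:~R ^+ 2 - 10 * (K%:~R ^+ 3 * D%:~R)
    + 180 * (b%:~R * K%:~R * D%:~R ^+ 2) - 675 * D%:~R ^+ 3 :> R by ring.
  move: hbK4 hb2K2D hb3D2 hK3D hbKD2 hD3.
  set p1 := b%:~R * K%:~R ^+ 4; set p2 := b%:~R ^+ 2 * _ * _.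
  set p3 := b%:~R ^+ 3 * _; set p4 := K%:~R ^+ 3 * _.
  set p5 := b%:~R * _ * _; set p6 := D%:~R ^+ 3 => q1 q2 q3 q4 q5 q6.
  have := ler_normB p1 (11 * p2); have := ler_normB (p1 - 11 * p2) p3.
  have := ler_normB (p1 - 11 * p2 - p3) (10 * p4).
  have := ler_normD (p1 - 11 * p2 - p3 - 10 * p4) (180 * p5).
  have := ler_normB (p1 - 11 * p2 - p3 - 10 * p4 + 180 * p5) (675 * p6).
  rewrite [`|11 * _|]normrM [`|10 * _|]normrM [`|180 * _|]normrM [`|675 * _|]normrM.
  rewrite !normr_nat (_ : 729%:~R = 729 :> R); last by ring.
  have := expR_gt0 (6%:R * nu); lra.
have bge := pb_b_ge pb.
have b0 : b%:~R != 0 :> R by rewrite -normr_gt0 (lt_le_trans _ bge) // expR_gt0.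
have hKb : `|K%:~R : R| <= `|b%:~R| ^+ 2.
  apply: (@le_trans _ _ (expR (t - u) ^+ 2)); last first.
    by rewrite lerXn2r ?nnegrE ?expR_ge0.
  apply: le_trans hK _; rewrite -expRM_natl ler_expR /eK.
  move: bK kap0 c0; rewrite gcE; lra.
have := p9_root_le hp9 b0 hKb => hK2.
have := ler_wpM2r (normr_ge0 (K%:~R : R)) hK2.
rewrite -exprSr -normrX => hK3.
move: hbKD; rewrite 2!normrM => hbKD; lra.
Qed.
End Gaps.

(** * Growth of the exponents *)

Section LinearArithmetic.
Variables (R : realType) (c u t s s' h : R).

Let eD : R := 4 * u - 2 * s + 2 * t - s'.
Let eP : R := u + t - s.
Let eK : R := 2 * t - 4 * s.
Let nu : R := t - s - h.

(* [eP], [eK], [eD], [nu] are the exponents of [b], [K], [D], [n] in [pair_bounds]. *)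
Definition gap_alternative : Prop :=
  2 * u - s' <= t - 2 * s -> u + c <= 2 * s ->
  3 * u + t - s - s' + c <= 0 -> u + 3 * h + c <= 2 * s ->
  [/\ 2 * s <= t + c,
      3 * eK + c <= 2 * nu -> eD + c <= nu -> False
    & eP + eK + eD + c <= 3 * nu -> 2 * eD + c <= 3 * nu ->
      3 * eD + c <= t - u ->
      3 * eK + c <= 3 * nu \/
      [/\ eP + 4 * eK + c <= 6 * nu,
          2 * eP + 2 * eK + eD + c <= 6 * nu,
          3 * eP + 2 * eD + c <= 6 * nu,
          3 * eK + eD + c <= 6 * nu
        & eP + eK + 2 * eD + c <= 6 * nu] -> False].

Hypothesis ga : gap_alternative.
Hypotheses (c0 : 0 <= c) (uc : 10 ^+ 4 * (c + 1) <= u).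
(** 19/8 is a rational lower bound for tau - 1; it keeps these inequalities linear. *)
Hypotheses (s_ge : 19 / 8 * h - c <= s) (h_le : h <= t - s + c).
Hypothesis s'_ge : 19 / 8 * (t - h) - 4 * c <= s'.

Lemma gap_first : 7 / 10 * u - 3 * c <= h -> 2 * s <= t + c.
Proof.
by move: ga c0 uc s_ge h_le s'_ge => ga' *; case: ga' => //; lra.
Qed.

Lemma gap_second : 11 / 14 * u <= h -> 5 / 2 * s - h / 2 <= t + c.
Proof.
move: ga c0 uc s_ge h_le s'_ge => ga' c0' uc' s_ge' h_le' s'_ge' hr.
rewrite leNgt; apply/negP => hlt.
case: ga'; try lra; rewrite /eK /eD /nu => ts o2 _.
by apply: o2; lra.
Qed.

(** Used twice: the alternative where K^3 itself is small forces 3 s - h <= t + c, and this sharper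
    lower bound for t yields the side conditions of the other alternative. *)
Lemma gap_third : 31 / 38 * u <= h -> 5 / 2 * s - h / 2 <= t + c ->
  11 * s - u - 6 * h <= 3 * t + 3 * c.
Proof.
move: ga c0 uc s_ge h_le s'_ge => ga' c0' uc' s_ge' h_le' s'_ge' hr t2.
case: ga'; try lra; rewrite /eK /eD /eP /nu => _ _ o3.
have {}o3 := o3 ltac:(lra) ltac:(lra) ltac:(lra).
have t3 : 3 * s - h <= t + c.
  by rewrite leNgt; apply/negP => hlt; apply: o3; left; lra.
by rewrite leNgt; apply/negP => hlt; apply: o3; right; split; lra.
Qed.
End LinearArithmetic.

Definition eventually_le (R : realType) (f g : nat -> R) : Prop :=
  exists k0, forall k, (k0 <= k)%N -> f k <= g k.

Section Growth.
Variables (R : realType) (th c : R) (u s h : nat -> R).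
Hypotheses (th_ge : 19 / 8 <= th) (th_root : 0 < 7 * th ^+ 2 - 20 * th + 8).
Hypotheses (c0 : 0 <= c) (h0 : forall k, 0 <= h k).
Hypothesis h_infty : forall A : R, eventually_le (fun=> A) h.
Hypothesis s_ge : forall k, th * h k - c <= s k.
Hypothesis u_le : forall k, u k.+1 <= h k + h k.+1 + c.
Hypothesis h_le : forall k, h k <= u k.+1 - s k + c.
Hypothesis s_le : forall k, s k <= 2 * u k + c.
Hypothesis gaps : forall k, gap_alternative c (u k) (u k.+1) (s k) (s k.+1) (h k).

Let s_ge_num k : 19 / 8 * h k - c <= s k.
Proof. by apply: le_trans (s_ge k); rewrite lerD2r ler_wpM2r. Qed.

Let u_infty (A : R) : eventually_le (fun=> A) u.
Proof.
have [k0 hk0] := h_infty (A + 2 * c); exists k0.+1 => -[//|k] /hk0 /= hk.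
have := h_le k; have := s_ge_num k; have := h0 k; lra.
Qed.

Let basic : exists k0, forall k, (k0 <= k)%N ->
  [/\ 10 ^+ 4 * (c + 1) <= u k, 7 / 10 * u k - 3 * c <= h k
    & 19 / 8 * (u k.+1 - h k) - 4 * c <= s k.+1].
Proof.
have [k0 hk0] := u_infty (10 ^+ 4 * (c + 1)); exists k0.+1 => -[//|k] hk; split.
- exact: hk0 (leqW hk).
(* Up to constants u_(k+1) >= h_k + s_k >= (27/8) h_k, so h_(k+1) >= u_(k+1) - h_k >= (19/27)
   u_(k+1), and 19/27 > 7/10. *)
- have := hk0 _ (leqW hk); have := c0.
  have := h_le k; have := s_ge_num k; have := u_le k; have := h0 k; lra.
- have := u_le k.+1; have := s_ge_num k.+2; have := c0; lra.
Qed.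

(** From a h_k <= u_(k+1) and u_(k+1) <= h_k + h_(k+1), up to constants, follows h_(k+1) >= (1 -
    1/a) u_(k+1); the strict inequality for b absorbs the constants. *)
Let ratio_of_gap (a b : R) : 0 < a -> b < 1 - a^-1 ->
  (exists C k0, forall k, (k0 <= k)%N -> a * h k <= u k.+1 + C) ->
  eventually_le (fun k => b * u k) h.
Proof.
move=> a0 hb [C [k0 hk0]].
have e0 : 0 < 1 - a^-1 - b by rewrite subr_gt0.
have [k1 hk1] := u_infty ((C / a + c) / (1 - a^-1 - b)).
exists (maxn k0 k1).+1 => -[//|k]; rewrite ltnS geq_max => /andP[hk hk'].
have h1 : h k <= (u k.+1 + C) / a by rewrite ler_pdivlMr // mulrC; exact: hk0.
have := hk1 _ (leqW hk'); rewrite ler_pdivrMr // => h2.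
have := u_le k; rewrite mulrDl in h1; lra.
Qed.

Let ratio_first : eventually_le (fun k => 11 / 14 * u k) h.
Proof.
(* 2 s <= t with s >= (19/8) h gives a = 19/4, and 1 - 4/19 = 15/19 just exceeds 11/14. *)
apply: (@ratio_of_gap (19 / 4)); [lra | lra | exists (3 * c)].
have [k0 hk0] := basic; exists k0 => k /hk0[b1 b2 b3].
have := gap_first (@gaps k) c0 b1 (s_ge_num k) (h_le k) b3 b2.
have := s_ge_num k; lra.
Qed.

Let gap_second_large : exists k0, forall k, (k0 <= k)%N ->
  5 / 2 * s k - h k / 2 <= u k.+1 + c.
Proof.
have [k0 hk0] := basic; have [k1 hk1] := ratio_first.
exists (maxn k0 k1) => k; rewrite geq_max => /andP[/hk0[b1 b2 b3] /hk1 hr].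
exact: gap_second (@gaps k) c0 b1 (s_ge_num k) (h_le k) b3 hr.
Qed.

Let ratio_second : eventually_le (fun k => 31 / 38 * u k) h.
Proof.
(* (5/2) (19/8) - 1/2 = 87/16, and 1 - 16/87 = 71/87 just exceeds 31/38. *)
apply: (@ratio_of_gap (87 / 16)); [lra | lra | exists (4 * c)].
have [k0 hk0] := gap_second_large; exists k0 => k /hk0.
have := s_ge_num k; have := c0; lra.
Qed.

Let gap_third_large : exists k0, forall k, (k0 <= k)%N ->
  11 * s k - u k - 6 * h k <= 3 * u k.+1 + 3 * c.
Proof.
have [k0 hk0] := basic; have [k1 hk1] := ratio_second.
have [k2 hk2] := gap_second_large; exists (maxn k0 (maxn k1 k2)) => k.
rewrite !geq_max => /and3P[/hk0[b1 b2 b3] /hk1 hr /hk2 h2].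
exact: gap_third (@gaps k) c0 b1 (s_ge_num k) (h_le k) b3 hr h2.
Qed.

Let th0 : 0 < th. Proof. by apply: lt_le_trans th_ge; lra. Qed.

Let ratio_le (r : R) : 0 <= r -> eventually_le (fun k => r * u k) h -> r * th <= 2.
Proof.
move=> r0 [k0 hk0]; rewrite leNgt; apply/negP => hr.
have e0 : 0 < r * th - 2 by rewrite subr_gt0.
have [k1 hk1] := u_infty ((2 * c + 1) / (r * th - 2)).
have := hk1 _ (leq_maxr k0 k1); rewrite ler_pdivrMr //.
have := ler_wpM2r (ltW th0) (hk0 _ (leq_maxl k0 k1)).
by have := s_ge (maxn k0 k1); have := s_le (maxn k0 k1); lra.
Qed.

Let ratio_step (r e : R) : 8 / 10 <= r -> 0 < e ->
  (r + e) * ((11 * th - 6) * r - 1) < (11 * th - 6) * r - 1 - 3 * r ->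
  eventually_le (fun k => r * u k) h -> eventually_le (fun k => (r + e) * u k) h.
Proof.
move=> hr e0 hre [k0 hk0].
have r0 : 0 < r by lra.
have A0 : 0 < (11 * th - 6) * r - 1.
  have h1 : 20 <= 11 * th - 6 by move: th_ge; lra.
  have := ler_wpM2r (ltW r0) h1; lra.
apply: (@ratio_of_gap (((11 * th - 6) * r - 1) / (3 * r))).
- by rewrite divr_gt0 // mulr_gt0.
- rewrite invf_div ltrBrDl addrC -ltrBrDl ltr_pdivrMr //; lra.
exists (c + 4 * th * c * 3); have [k1 hk1] := gap_third_large; have [k2 hk2] := basic.
exists (maxn k0 (maxn k1 k2)) => k; rewrite !geq_max => /and3P[/hk0 a0 /hk1 a1 /hk2[b1 _ _]].
rewrite mulrAC ler_pdivrMr ?mulr_gt0 //.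
have := ler_wpM2l (ltW r0) a1; have := ler_wpM2l (ltW r0) (s_ge k).
have c0' := c0; have rc : 0 <= r * c by rewrite mulr_ge0 // ltW.
have := ler_wpM2l rc th_ge.
rewrite mulrBl mul1r; lra.
Qed.

(** A lower bound r for h / u improves as long as f(r) > 0, and cannot exceed 2 / th because th h <=
    s <= 2 u up to constants. Since f(2 / th) is a positive multiple of 7 th^2 - 20 th + 8, f stays
    above some m > 0 on the whole admissible range, so r grows by a fixed step without end. *)
Lemma growth_contradiction : False.
Proof.
set A := 11 * th - 6; have hA : 20 <= A by rewrite /A; move: th_ge; lra.
pose f r := A * r - 1 - 3 * r - r * (A * r - 1).
pose d := 3 * (7 * th ^+ 2 - 20 * th + 8) / th ^+ 2.
have d0 : 0 < d by rewrite /d divr_gt0 ?exprn_gt0 // mulr_gt0.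
have f_lo : 1 / 2 <= f (8 / 10) by rewrite /f; lra.
have f_hi : f (2 / th) = d.
  by rewrite /f /d /A; field; rewrite gt_eqF.
pose m := Num.min (1 / 2) d.
have m0 : 0 < m by rewrite lt_min d0 andbT; lra.
have f_ge r : 8 / 10 <= r -> r * th <= 2 -> m <= f r.
  move=> r1 r2.
  have r3 : r <= 2 / th by rewrite ler_pdivlMr.
  have m1 : m <= 1 / 2 by rewrite ge_min lexx.
  have m2 : m <= d by rewrite ge_min lexx orbT.
  have [hlt|] := ltP (8 / 10) (2 / th); last first.
    move=> hle; have -> : r = 8 / 10 by apply: le_anti; rewrite r1 andbT (le_trans r3).
    exact: le_trans f_lo.
  set q := 2 / th in r3 f_hi hlt; rewrite -f_hi in m2.
  (* Concavity: f is quadratic with leading coefficient - A, so it lies above its chord by A (q - r)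
     (r - 8/10), which is the term [g3]. *)
  have : (q - 8 / 10) * m <= (q - 8 / 10) * f r.
    have g1 : 0 <= (r - 8 / 10) * (f q - m) by rewrite mulr_ge0 // subr_ge0.
    have g2 : 0 <= (q - r) * (f (8 / 10) - m).
      by rewrite mulr_ge0 // subr_ge0 // (le_trans m1).
    have g3 : 0 <= A * ((q - 8 / 10) * ((q - r) * (r - 8 / 10))).
      rewrite mulr_ge0 ?(le_trans _ hA) // mulr_ge0 ?subr_ge0 ?(ltW hlt) //.
      by rewrite mulr_ge0 // subr_ge0.
    by rewrite /f in g1 g2 *; lra.
  by rewrite ler_pM2l // subr_gt0.
(* As r <= 1, the step costs e (A r - 1) <= m / 2, which is less than f(r). *)
pose e := m / (2 * A).
have A0 : 0 < A by apply: lt_le_trans hA.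
have e0 : 0 < e by rewrite divr_gt0 // mulr_gt0.
have step j : eventually_le (fun k => (8 / 10 + j%:R * e) * u k) h.
  elim: j => [|j IH].
    have [k0 hk0] := ratio_second; have [k1 hk1] := basic.
    exists (maxn k0 k1) => k; rewrite geq_max => /andP[/hk0 hr /hk1[b1 _ _]].
    by have := c0; lra.
  have je : 0 <= j%:R * e by rewrite mulr_ge0 // ltW.
  have r1 : 8 / 10 <= 8 / 10 + j%:R * e by rewrite lerDl.
  have r2 := ratio_le (le_trans _ r1) IH.
  have -> : 8 / 10 + j.+1%:R * e = 8 / 10 + j%:R * e + e by rewrite -natr1; ring.
  apply: ratio_step => //.
  have := f_ge _ r1 (r2 _); rewrite /f -/A.
  set r := 8 / 10 + _ => /(_ ltac:(lra)) hf.
  have r1' : r <= 1.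
    have : r * (19 / 8) <= r * th by rewrite ler_wpM2l // (le_trans _ r1).
    by have := r2 ltac:(lra); rewrite -/r; lra.
  have eA : e * A = m / 2 by rewrite /e; field; rewrite gt_eqF.
  have : e * (A * r - 1) <= e * A * 1.
    by rewrite -mulrA ler_pM2l // mulr1; have := ler_wpM2l (ltW A0) r1'; lra.
  by rewrite eA; lra.
have [j hj] : exists j : nat, 2 < j%:R * e.
  exists (Num.bound (2 / e)); rewrite -ltr_pdivrMr // archi_boundP //.
  by rewrite divr_ge0 // ltW.
have := ratio_le _ (step j).
have : 2 * th <= (8 / 10 + j%:R * e) * th by rewrite ler_pM2r //; lra.
by move: th_ge; lra.
Qed.
End Growth.

(** * Minimal linear forms *)

Lemma seq_argmin (R : realDomainType) (T : eqType) (F : T -> R) (s : seq T) :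
  s != [::] -> exists2 x, x \in s & forall y, y \in s -> F x <= F y.
Proof.
elim: s => // a s IH _; have [->|/IH[x xs hx]] := eqVneq s [::].
  by exists a => [|y]; rewrite ?mem_seq1 // => /eqP ->.
have [ax|xa] := leP (F a) (F x).
  exists a => [|y]; rewrite ?mem_head // inE => /orP[/eqP -> //|/hx].
  exact: le_trans.
exists x => [|y]; rewrite inE ?xs ?orbT // => /orP[/eqP ->|/hx //].
exact: ltW.
Qed.

Lemma scale1 (u : vec) : scale 1 u = u.
Proof. by apply: vec_eqP; rewrite /= mul1r. Qed.

Lemma dot_scale (g : int) (u v : vec) : dot u (scale g v) = g * dot u v.
Proof. by rewrite /dot /=; ring. Qed.

Lemma dotC (u v : vec) : dot u v = dot v u.
Proof. by rewrite /dot; ring. Qed.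

Lemma dot_crossl (u v : vec) : dot u (cross u v) = 0.
Proof. by rewrite /dot /=; ring. Qed.

Lemma dot_crossr (u v : vec) : dot v (cross u v) = 0.
Proof. by rewrite /dot /=; ring. Qed.

Lemma vec_neq0 (v : vec) : v != 0 ->
  [|| v.1.1 != 0, v.1.2 != 0 | v.2 != 0].
Proof.
apply: contraNT; rewrite !negb_or !negbK => /and3P[/eqP h0 /eqP h1 /eqP h2].
by apply/eqP/vec_eqP.
Qed.

Lemma scale_eq0 (g : int) (v : vec) : v != 0 -> (scale g v == 0) = (g == 0).
Proof.
move=> /vec_neq0 hv; apply/eqP/eqP => [h|->]; last by apply: vec_eqP; rewrite /= mul0r.
move: (congr1 (fun w => w.1.1) h) (congr1 (fun w => w.1.2) h) (congr1 snd h) => /=.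
by case/or3P: hv => hv /eqP + /eqP + /eqP; rewrite !mulf_eq0 (negPf hv) ?orbF => h0 h1 h2;
  apply/eqP.
Qed.

Lemma cross_eq0 (x z : vec) : primitive x -> cross x z = 0 ->
  exists m, z = scale m x.
Proof.
move=> [r hr] h; have := @cross_lift 0 0 x z r.
rewrite h; case=> [|//|y [h0 h1 h2]]; first by apply: vec_eqP; rewrite /= mulr0.
by exists (dot r z); apply: vec_eqP; rewrite /= ?h0 ?h1 ?h2 !mul0r add0r.
Qed.

Lemma height_gt0 (v : vec) : v != 0 -> (0 < height v)%N.
Proof. by move/vec_neq0; rewrite /height; lia. Qed.

Lemma height_scale (m : int) (v : vec) : height (scale m v) = (`|m| * height v)%N.
Proof. by rewrite /height /= !abszM !maxnMr. Qed.

Lemma height_box (N : nat) : exists s : seq vec,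
  forall v, (v \in s) = (v != 0) && (height v <= N)%N.
Proof.
pose L : seq int := [seq i%:Z - N%:Z | i <- iota 0 (2 * N).+1].
have memL a : (a \in L) = (`|a|%N <= N)%N.
  apply/mapP/idP => [[i]|ha]; first by rewrite mem_iota => hi ->; lia.
  by exists `|(a + N%:Z)%R|%N; rewrite ?mem_iota; lia.
move: L memL => L memL.
exists [seq v <- [seq (p, c) | p <- [seq (a, b) | a <- L, b <- L], c <- L] | v != 0].
move=> v; rewrite mem_filter; congr (_ && _).
apply/idP/idP => [/allpairsP[[p c] /= [hp hc ->]]|].
  have [[a b] /= [ha hb hab]] := allpairsP hp.
  by move: ha hb hc; rewrite hab !memL /height /=; lia.
case: v => [[a b] c]; rewrite /height /= => hv.
apply/allpairsP; exists ((a, b), c) => /=; rewrite memL; split=> //; last lia.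
by apply/allpairsP; exists (a, b); rewrite /= !memL; split=> //; lia.
Qed.

Definition form_val (R : realType) (xi : R) (P : vec) : R :=
  P.1.1%:~R + P.1.2%:~R * xi + P.2%:~R * xi ^+ 3.

Lemma apx_gt0 (R : realType) (xi : R) (v : vec) :
  (forall P : vec, form_val xi P = 0 -> P = 0) -> v != 0 -> 0 < apx xi v.
Proof.
move=> indep v0; rewrite lt_def; apply/andP; split; last by rewrite /apx le_max normr_ge0.
apply: contra v0 => /eqP h; have [h1 h2] := apx_ge xi v; rewrite h in h1 h2.
move: h1 h2; rewrite !normr_le0 => /eqP h1 /eqP h2.
have /indep[v10 v00] : form_val xi (- v.1.2, v.1.1, 0) = 0.
  by rewrite -[RHS]oppr0 -h1 /form_val /=; ring.
have v20 : form_val xi (v.2, 0, - v.1.1) = 0 by rewrite -[RHS]h2 /form_val /=; ring.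
have /indep[v20' _] := v20.
by apply/eqP; apply: vec_eqP => /=; lia.
Qed.

(* [P k] is normal to the plane spanned by the consecutive points [x k] and
   [x k.+1]. *)
Record minimal_points (R : realType) (xi th C : R) (x P : nat -> vec) : Prop :=
  MinimalPoints {
    mp_x : forall k, primitive (x k);
    mp_P : forall k, primitive (P k);
    mp_perp : forall k, dot (P k) (x k) = 0;
    mp_perpS : forall k, dot (P k) (x k.+1) = 0;
    mp_cross : forall k, cross (x k) (x k.+1) != 0;
    mp_apx : forall k, apx xi (x k) <= C * (height (P k))%:R `^ (- th);
    mp_x0 : forall k, (`|(x k.+1).1.1| <= 2 * height (P k) * height (P k.+1))%N;
    mp_mono : forall k, (height (P k) <= height (P k.+1))%N;
    mp_infty : forall A, exists k0, forall k, (k0 <= k)%N -> (A < height (P k))%N }.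

Section MinimalForms.
Variables (R : realType) (xi tau : R).

Notation form_val := (form_val xi).

Hypothesis indep : forall P : vec, form_val P = 0 -> P = 0.
Hypothesis tau1 : 1 < tau.
Hypothesis small : exists N0 : nat, forall N : nat, (N0 <= N)%N ->
  exists P : vec, [/\ P != 0, (height P <= N)%N & `|form_val P| <= N%:R `^ (- tau)].

Let form_val_scale (m : int) (P : vec) : form_val (scale m P) = m%:~R * form_val P.
Proof. by rewrite /form_val /=; ring. Qed.

Let form_val_gt0 (P : vec) : P != 0 -> 0 < `|form_val P|.
Proof. by rewrite normr_gt0; apply: contra => /eqP/indep ->. Qed.

Let form_val_eq (P Q : vec) : `|form_val P| = `|form_val Q| ->
  exists2 e : int, `|e|%N = 1%N & P = scale e Q.
Proof.
move=> /eqP; rewrite eqr_norm2 => /orP[] /eqP h.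
- exists 1 => //; rewrite scale1.
  have /indep : form_val (P.1.1 - Q.1.1, P.1.2 - Q.1.2, P.2 - Q.2) = 0.
    by rewrite -(subrr (form_val Q)) -{1}h /form_val /=; ring.
  by move=> [/subr0_eq h0 /subr0_eq h1 /subr0_eq h2]; apply: vec_eqP.
- exists (-1) => //.
  have /indep : form_val (P.1.1 + Q.1.1, P.1.2 + Q.1.2, P.2 + Q.2) = 0.
    by rewrite -(addNr (form_val Q)) -h /form_val /=; ring.
  by move=> [h0 h1 h2]; apply: vec_eqP => /=; lia.
Qed.

Lemma minimal_form_exists (N : nat) : exists P : vec, (0 < N)%N ->
  [/\ P != 0, (height P <= N)%N
    & forall Q : vec, Q != 0 -> (height Q <= N)%N -> `|form_val P| <= `|form_val Q|].
Proof.
have [s hs] := height_box N.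
have [->|N0] := posnP N; first by exists 0.
have s0 : s != [::].
  have : (1, 0, 0) \in s by rewrite hs /height /= N0.
  by case: (s).
have [P + hP] := seq_argmin (fun P => `|form_val P|) s0.
rewrite hs => /andP[P0 PN]; exists P => _; split=> // Q Q0 QN.
by apply: hP; rewrite hs Q0.
Qed.

Variable mn : nat -> vec.
Hypothesis mnP : forall N, (0 < N)%N ->
  [/\ mn N != 0, (height (mn N) <= N)%N
    & forall Q : vec, Q != 0 -> (height Q <= N)%N -> `|form_val (mn N)| <= `|form_val Q|].

Let mn_small : exists2 N0 : nat, (0 < N0)%N & forall N : nat, (N0 <= N)%N ->
  `|form_val (mn N)| <= N%:R `^ (- tau).
Proof.
have [N0 hN0] := small; exists N0.+1 => // N hN.
have [P [P0 PN hP]] := hN0 _ (ltnW hN).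
by have [_ _ hmin] := mnP (leq_ltn_trans (leq0n _) hN); apply: le_trans hP; exact: hmin.
Qed.

Let mn_primitive N : (0 < N)%N -> primitive (mn N).
Proof.
move=> N0; have [P0 PN hP] := mnP N0.
have [g [v [g0 pv hv]]] := primitive_gcd P0.
have v0 := primitive_neq0 pv.
have hgv : (height v <= N)%N.
  by apply: leq_trans PN; rewrite hv height_scale leq_pmull //; lia.
have := hP v v0 hgv; rewrite {1}hv form_val_scale normrM.
rewrite ger_pMl ?form_val_gt0 // -intr_norm -[1]/(1%:~R) ler_int => g1.
by rewrite hv (_ : g = 1) ?scale1 //; lia.
Qed.

Let mn_eq i j : (0 < i)%N -> (0 < j)%N -> (height (mn i) <= j)%N ->
  (height (mn j) <= i)%N -> exists2 e : int, `|e|%N = 1%N & mn i = scale e (mn j).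
Proof.
move=> i0 j0 hij hji; apply: form_val_eq; apply: le_anti.
have [Pi0 _ hi] := mnP i0; have [Pj0 _ hj] := mnP j0.
by rewrite hi ?hj.
Qed.

Let height_unit (e : int) v : `|e|%N = 1%N -> height (scale e v) = height v.
Proof. by move=> he; rewrite height_scale he mul1n. Qed.

(** A minimal form is already minimal for the bound equal to its own height. The unit [e] is needed
    because [mn] chooses signs arbitrarily. *)
Let birth i : (0 < i)%N ->
  exists2 e : int, `|e|%N = 1%N & mn (height (mn i)) = scale e (mn i).
Proof.
move=> i0; have [P0 PN _] := mnP i0; have B0 := height_gt0 P0.
by apply: mn_eq => //; have [_ hB _] := mnP B0; exact: leq_trans PN.
Qed.

Let height_birth i : (0 < i)%N -> height (mn (height (mn i))) = height (mn i).
Proof. by move=> i0; have [e he ->] := birth i0; exact: height_unit. Qed.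

Let height_mono i j : (0 < i)%N -> (i <= j)%N -> (height (mn i) <= height (mn j))%N.
Proof.
move=> i0 ij; have j0 : (0 < j)%N by exact: leq_trans ij.
have [_ hi _] := mnP i0; have [hji|hji] := leqP (height (mn j)) i; last first.
  exact: leq_trans hi (ltnW hji).
have [//|e he ->] := mn_eq i0 j0 _ hji; first exact: leq_trans ij.
by rewrite height_unit.
Qed.

Let cross_birth N : (0 < N)%N -> height (mn N.+1) = N.+1 ->
  cross (mn N) (mn N.+1) != 0.
Proof.
move=> N0 hN; apply/eqP => hc.
have [m hm] := cross_eq0 (mn_primitive N0) hc.
have [P0 PN _] := mnP N0; have [Q0 QN hQ] := mnP (ltn0Sn N).
have := hQ _ P0 (leqW PN); rewrite hm form_val_scale normrM.
rewrite ger_pMl ?form_val_gt0 // -intr_norm -[1]/(1%:~R) ler_int => m1.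
have : (height (mn N.+1) <= N)%N.
  rewrite hm height_scale; apply: leq_trans PN.
  by rewrite -[leqRHS]mul1n leq_mul2r; apply/orP; right; lia.
by rewrite hN ltnn.
Qed.

Let cross_height N : (0 < N)%N -> cross (mn N) (mn N.+1) != 0 ->
  height (mn N.+1) = N.+1.
Proof.
move=> N0 hc; have [P0 PN _] := mnP N0; have [_ QN _] := mnP (ltn0Sn N).
apply/eqP; rewrite eqn_leq QN ltnNge /=; apply: contra hc => hN.
have [e _ ->] := mn_eq N0 (ltn0Sn N) (leqW PN) hN.
by apply/eqP; apply: vec_eqP => /=; ring.
Qed.

(** By the triple product identity, the cross product of (1, xi, xi^3) with cross P Q is a
    combination of P and Q whose coefficients are, up to sign, the values of Q and P at xi. *)
Let apx_cross (P Q : vec) (B : nat) (e : R) : (height P <= B)%N -> (height Q <= B)%N ->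
  `|form_val P| <= e -> `|form_val Q| <= e ->
  apx xi (cross P Q) <= 2 * B%:R * e.
Proof.
move=> hP hQ vP vQ.
have nb (p : int) S : `|p| <= height S -> (height S <= B)%N -> `|p%:~R : R| <= B%:R.
  by move=> h1 h2; rewrite -intr_norm -[B%:R]/(B%:Z%:~R) ler_int; lia.
have [_ P1 P2] := height_ge P; have [_ Q1 Q2] := height_ge Q.
have b (p q : int) : `|p%:~R : R| <= B%:R -> `|q%:~R : R| <= B%:R ->
    `|p%:~R * form_val Q - q%:~R * form_val P| <= 2 * B%:R * e.
  move=> hp hq; apply: le_trans (ler_normB _ _) _.
  have := norm_mul_le hp vQ; have := norm_mul_le hq vP; lra.
rewrite /apx ge_max; apply/andP; split.
- have := b _ _ (nb _ _ P2 hP) (nb _ _ Q2 hQ).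
  by congr (`|_| <= _); rewrite /form_val /=; ring.
- have := b _ _ (nb _ _ P1 hP) (nb _ _ Q1 hQ); rewrite distrC.
  by congr (`|_| <= _); rewrite /form_val /=; ring.
Qed.

Let apx_scale (g : int) v : apx xi (scale g v) = `|g%:~R| * apx xi v.
Proof.
rewrite /apx maxr_pMr // -!normrM !mulrBr /= !rmorphM /=.
by rewrite !mulrA.
Qed.


Let C : R := 2 * 2 `^ tau.

Let apx_le : exists2 N0 : nat, (0 < N0)%N &
  forall (N : nat) (z : vec), (N0 <= N)%N -> height (mn N.+1) = N.+1 ->
    primitive z -> dot (mn N) z = 0 -> dot (mn N.+1) z = 0 ->
    apx xi z <= C * N.+1%:R `^ (- (tau - 1)).
Proof.
have [N0 N00 hN0] := mn_small; exists N0 => // N z hN hB pz d0 d1.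
have N_gt0 : (0 < N)%N by exact: leq_trans hN.
have [P0 PN _] := mnP N_gt0; have [_ QN hQ] := mnP (ltn0Sn N).
have [g hg] := cross_primitive pz (etrans (dotC _ _) d0) (etrans (dotC _ _) d1).
have g0 : g != 0.
  have := cross_birth N_gt0 hB; rewrite hg.
  by rewrite scale_eq0 // primitive_neq0.
have vN := hN0 _ hN.
have := apx_cross (leqW PN) QN (lexx _) (hQ _ P0 (leqW PN)).
rewrite hg apx_scale => hle.
apply: (@le_trans _ _ (`|g%:~R| * apx xi z)).
  by rewrite ler_peMl ?norm_int_cast_ge1 // ltW // (apx_gt0 indep) // primitive_neq0.
apply: le_trans hle _.
have N1 : (0 : R) < N.+1%:R by rewrite ltr0n.
have -> : C * N.+1%:R `^ (- (tau - 1)) = 2 * N.+1%:R * (2 `^ tau * N.+1%:R `^ (- tau)).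
  rewrite opprB powRD; last by rewrite (gt_eqF N1) implybT.
  by rewrite powRr1 ?ltW // /C; ring.
rewrite ler_wpM2l ?mulr_ge0 //; apply: le_trans vN _.
have hp : N.+1%:R `^ tau <= 2 `^ tau * N%:R `^ tau :> R.
  rewrite -powRM // ge0_ler_powR ?nnegrE ?mulr_ge0 // ?(ltW (lt_trans ltr01 tau1)) //.
  by rewrite -natrM ler_nat; lia.
rewrite !powRN ler_pdivlMr ?powR_gt0 // mulrC ler_pdivrMr ?powR_gt0 //.
by rewrite ltr0n.
Qed.

Let height_infty (A : nat) : exists N0, forall N, (N0 <= N)%N ->
  (A < height (mn N))%N.
Proof.
have [N0 N00 hN0] := mn_small.
have [P0 PA hP] := mnP (ltn0Sn A).
have v0 := form_val_gt0 P0.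
exists (maxn N0 (Num.bound (`|form_val (mn A.+1)|^-1)).+1) => N.
rewrite geq_max => /andP[h1 h2]; have N_gt0 : (0 < N)%N by exact: leq_trans h1.
rewrite ltnNge; apply/negP => hA.
have [Q0 QN _] := mnP N_gt0.
have := le_trans (hP _ Q0 (leqW hA)) (hN0 _ h1).
rewrite leNgt => /negP[].
have N1 : (1 : R) <= N%:R by rewrite ler1n.
apply: (@le_lt_trans _ _ (N%:R `^ (-1))).
  by apply: ler_powR => //; rewrite lerN2 ltW.
rewrite powRN powRr1 // invf_plt ?posrE ?ltr0n //.
apply: lt_le_trans (archi_boundP _) _; first by rewrite invr_ge0.
by rewrite ler_nat (leq_trans _ h2).
Qed.

Let powR_gt (a y : R) : 0 < a ->
  exists A, forall B, (A <= B)%N -> y < B%:R `^ a.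
Proof.
move=> a0; pose y1 := Num.max y 0 + 1.
have y10 : 0 <= y1 by rewrite addr_ge0 // le_max lexx orbT.
exists (Num.bound (y1 `^ a^-1)) => B hB.
apply: (@lt_le_trans _ _ y1); first by rewrite /y1 ltr_pwDr // le_max lexx.
have -> : y1 = (y1 `^ a^-1) `^ a by rewrite -powRrM mulVf ?gt_eqF // powRr1.
rewrite ge0_ler_powR ?nnegrE ?powR_ge0 ?(ltW a0) //.
apply: le_trans (ltW (archi_boundP _)) _; first exact: powR_ge0.
by rewrite ler_nat.
Qed.

(** If z were perpendicular to all later minimal forms, [apx_le] would force its approximation
    error, a fixed positive number, below every bound. *)
Let dot_unbounded N z : primitive z -> exists2 M, (N <= M)%N & dot (mn M) z != 0.
Proof.
move=> pz; apply: contrapT => hN.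
have hz M : (N <= M)%N -> dot (mn M) z = 0.
  by move=> NM; apply: contrapT => /eqP h; apply: hN; exists M.
have [N0 N00 hN0] := apx_le; have az := apx_gt0 indep (primitive_neq0 pz).
have tau0 : 0 < tau - 1 by rewrite subr_gt0.
have [A hA] := powR_gt (C / apx xi z) tau0.
have [i0 hi0] := height_infty (maxn (maxn N0 N) A).+1.
have := hi0 (maxn i0 1) (leq_maxl _ _); set i := maxn i0 1.
have i_gt0 : (0 < i)%N by rewrite /i leq_max orbT.
have := height_birth i_gt0; case: (height (mn i)) => // B hB.
rewrite ltnS => hlt; have := hN0 B z _ hB pz (hz _ _) (hz _ _).
have B0 : (0 : R) < B.+1%:R by rewrite ltr0n.
have hBA := hA B.+1; rewrite ltr_pdivrMr // mulrC in hBA.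
rewrite powRN ler_pdivlMr ?powR_gt0 // leNgt hBA; last by lia.
by move=> h; have := h ltac:(lia) ltac:(lia) ltac:(lia).
Qed.

(** By [cross_birth] and [cross_height], these are the positive bounds at which the minimal form
    changes, the new form having height exactly N + 1. *)
Let good N := (0 < N)%N && (cross (mn N) (mn N.+1) != 0).

Lemma next_minimal_exists N z : primitive z -> good N ->
  dot (mn N) z = 0 -> dot (mn N.+1) z = 0 ->
  exists M, [/\ (N < M)%N, good M, dot (mn M.+1) z != 0
    & forall i, (N <= i <= M)%N -> dot (mn i) z = 0].
Proof.
move=> pz /andP[N0 _] d0 d1.
have [m hm1 hm2] := dot_unbounded N.+2 pz.
have ex : exists m, (N < m)%N && (dot (mn m.+1) z != 0).
  by case: m hm1 hm2 => // m h1 h2; exists m; rewrite h2 andbT; lia.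
case: (ex_minnP ex) => M /andP[NM hM] hmin.
have hperp i : (N <= i <= M)%N -> dot (mn i) z = 0.
  move=> /andP[Ni iM]; have [->//|iN] := eqVneq i N; have [->//|iN1] := eqVneq i N.+1.
  case: i Ni iM iN iN1 => [|i] Ni iM iN iN1; first by lia.
  apply/eqP; apply: contraT => hi.
  by have := hmin i; rewrite hi andbT => /(_ ltac:(lia)); lia.
exists M; split=> //; rewrite /good (leq_ltn_trans _ NM) //.
apply/eqP => hcM; have M0 : (0 < M)%N by exact: leq_ltn_trans NM.
have [g hg] := cross_eq0 (mn_primitive M0) hcM.
by move: hM; rewrite hg dotC dot_scale dotC hperp ?mulr0 ?eqxx // leqnn ltnW.
Qed.

Variable pr : vec -> vec.
Hypothesis prP : forall v, v != 0 ->
  exists g : int, [/\ 0 < g, primitive (pr v) & v = scale g (pr v)].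

Let point N := pr (cross (mn N) (mn N.+1)).

Lemma point_perp N : good N ->
  [/\ primitive (point N), dot (mn N) (point N) = 0 & dot (mn N.+1) (point N) = 0].
Proof.
move=> /andP[_ /prP[g [g0 pp hg]]]; split=> //; apply/eqP.
- by have := dot_crossl (mn N) (mn N.+1); rewrite hg dot_scale => /eqP;
    rewrite mulf_eq0 gt_eqF.
- by have := dot_crossr (mn N) (mn N.+1); rewrite hg dot_scale => /eqP;
    rewrite mulf_eq0 gt_eqF.
Qed.

Let point0_le N : good N ->
  (`|(point N).1.1| <= 2 * height (mn N) * height (mn N.+1))%N.
Proof.
move=> /andP[_ /prP[g [g0 pp hg]]]; rewrite -/(point N) in hg.
have := congr1 (fun v => v.1.1) hg => /= h.
have [_ a1 a2] := height_ge (mn N); have [_ b1 b2] := height_ge (mn N.+1).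
apply: (@leq_trans `|(g * (point N).1.1)%R|%N); first by rewrite abszM leq_pmull; lia.
rewrite -h.
have c1 := leq_mul (_ : `|(mn N).1.2| <= height (mn N))%N
  (_ : `|(mn N.+1).2| <= height (mn N.+1))%N.
have c2 := leq_mul (_ : `|(mn N).2| <= height (mn N))%N
  (_ : `|(mn N.+1).1.2| <= height (mn N.+1))%N.
rewrite -!abszM in c1 c2.
have := c1 ltac:(lia) ltac:(lia); have := c2 ltac:(lia) ltac:(lia).
by rewrite -mulnA; lia.
Qed.

Variable nx : nat -> nat.
Hypothesis nxP : forall N, good N ->
  [/\ (N < nx N)%N, good (nx N), dot (mn (nx N).+1) (point N) != 0
    & forall i, (N <= i <= nx N)%N -> dot (mn i) (point N) = 0].

Let good_infty N0 : exists2 N, (N0 <= N)%N & good N.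
Proof.
have [i0 hi0] := height_infty N0.+1.
have := hi0 (maxn i0 1) (leq_maxl _ _); set i := maxn i0 1.
have i_gt0 : (0 < i)%N by rewrite /i leq_max orbT.
have := height_birth i_gt0; case: (height (mn i)) => // -[//|B] hB h.
by exists B.+1; rewrite /good ?cross_birth //; lia.
Qed.

Lemma minimal_points_exist : exists x P, minimal_points xi (tau - 1) C x P.
Proof.
have [N0 N00 hN0] := apx_le; have [N1 N01 g1] := good_infty N0.
pose Nk k := iter k nx N1.
have goodNk k : good (Nk k) by elim: k => //= k /nxP[].
have ltNk k : (Nk k < Nk k.+1)%N by have [] := nxP (goodNk k).
have leNk k : (N1 + k <= Nk k)%N.
  by elim: k => [|k IH]; rewrite ?addn0 // addnS (leq_trans _ (ltNk k)).
have gt0Nk k : (0 < Nk k)%N by case/andP: (goodNk k).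
(* The k-th form is the last minimal one before perpendicularity to the k-th point fails; it is also
   one of the two forms that define the next point. *)
exists (fun k => point (Nk k)), (fun k => mn (Nk k.+1)); split=> k.
- by have [] := point_perp (goodNk k).
- exact: mn_primitive.
- by have [_ _ _ ->] := nxP (goodNk k); rewrite // leqnn ltnW.
- by have [] := point_perp (goodNk k.+1).
- apply/eqP => hc; have [pk _ _] := point_perp (goodNk k).
  have [m hm] := cross_eq0 pk hc; have [pk1 _ hd] := point_perp (goodNk k.+1).
  have [_ _ hne _] := nxP (goodNk k); move/eqP: hd.
  rewrite [Nk k.+1]/= -/(Nk k) in hm *.
  rewrite hm dot_scale mulf_eq0 (negPf hne) orbF => /eqP m0.
  by move/eqP: (primitive_neq0 pk1); apply; rewrite hm m0; apply: vec_eqP; rewrite /= mul0r.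
- have [NM gM _ hp] := nxP (goodNk k); have [pk _ _] := point_perp (goodNk k).
  rewrite [Nk k.+1]/= -/(Nk k); set M := nx (Nk k) in NM gM hp *.
  have M0 : (0 < M)%N by case/andP: gM.
  have [PM0 PMM _] := mnP M0.
  (* The error must be bounded by the height of the form and not by the index M. So M is replaced by
     that height, and this inequality keeps both indices B and B + 1 in the range where the forms
     are perpendicular to the point. *)
  have hB : (Nk k < height (mn M))%N.
    case/andP: (goodNk k) => n0 nc; rewrite -(cross_height n0 nc).
    exact: height_mono.
  have [e he hbirth] := birth M0; have hBB := height_birth M0.
  case: (height (mn M)) hB PMM hbirth hBB => // B hB PMM hbirth hBB.
  apply: hN0 => //.
  + exact: leq_trans N01 (leq_trans (leq_trans (leq_addr k N1) (leNk k)) hB).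
  + by apply: hp; rewrite -ltnS hB ltnW.
  + rewrite hbirth dotC dot_scale dotC hp ?mulr0 // leqnn andbT; exact: ltnW.
- apply: leq_trans (point0_le (goodNk k.+1)) _.
  by rewrite leq_mul2l; apply/orP; right; apply: height_mono => //; exact: ltNk.
- by apply: height_mono => //; exact: ltnW.
- have [i0 hi0] := height_infty k; exists i0 => j hj; apply: hi0.
  exact: leq_trans hj (leq_trans (leq_trans (leqnSn j) (leq_addl N1 _)) (leNk j.+1)).
Qed.
End MinimalForms.

Lemma minimal_points_of_small (R : realType) (xi tau : R) :
  (forall P : vec, form_val xi P = 0 -> P = 0) -> 1 < tau ->
  (exists N0 : nat, forall N : nat, (N0 <= N)%N ->
    exists P : vec, [/\ P != 0, (height P <= N)%N & `|form_val xi P| <= N%:R `^ (- tau)]) ->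
  exists x P, minimal_points xi (tau - 1) (2 * 2 `^ tau) x P.
Proof.
move=> indep tau1 small.
have [mn mnP] := choice (@minimal_form_exists R xi).
have [pr prP] : exists pr : vec -> vec, forall v, v != 0 ->
    exists g : int, [/\ 0 < g, primitive (pr v) & v = scale g (pr v)].
  have h v : exists w, v != 0 -> exists g : int, [/\ 0 < g, primitive w & v = scale g w].
    have [->|/primitive_gcd[g [w hw]]] := eqVneq v 0; first by exists 0.
    by exists w => _; exists g.
  by have [pr hpr] := choice h; exists pr.
pose good N := (0 < N)%N && (cross (mn N) (mn N.+1) != 0).
pose point N := pr (cross (mn N) (mn N.+1)).
have hnx N : exists M, good N -> [/\ (N < M)%N, good M, dot (mn M.+1) (point N) != 0
    & forall i, (N <= i <= M)%N -> dot (mn i) (point N) = 0].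
  case gN : (good N); last by exists 0%N.
  have [pp d0 d1] := point_perp prP gN.
  by have [M hM] := next_minimal_exists indep tau1 small mnP pp gN d0 d1; exists M.
have [nx nxP] := choice hnx.
by have := minimal_points_exist indep tau1 small mnP prP nxP.
Qed.

(** * From minimal points to the growth argument *)

Section Contradiction.
Variables (R : realType) (xi th C : R) (x P : nat -> vec).
Hypothesis indep : forall P : vec, form_val xi P = 0 -> P = 0.
Hypotheses (C0 : 0 < C) (th_ge : 19 / 8 <= th).
Hypothesis th_root : 0 < 7 * th ^+ 2 - 20 * th + 8.
Hypothesis mp : minimal_points xi th C x P.

Let u k : R := ln `|(x k).1.1%:~R|.
Let s k : R := - ln (apx xi (x k)).
Let h k : R := ln (height (P k))%:R.
Let pc : R := pair_const xi.
Let c : R := gap_const pc + 12 * pc + 1 + ln 2 + `|ln C|.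

Let pc0 : 0 <= pc. Proof. exact: pair_const_ge0. Qed.
Let ln2 : 0 <= ln 2 :> R. Proof. by rewrite ln_ge0 // ler1n. Qed.
Let gc0 : 20 * pc <= gap_const pc.
Proof. by rewrite /gap_const lerDl mulr_ge0 // ln_ge0 // exprn_ege1 // ler1n. Qed.
Let c1 : 1 <= c.
Proof. by have := pc0; have := ln2; have := gc0; have := normr_ge0 (ln C); rewrite /c; lra. Qed.

Let hE k : (height (P k))%:R = expR (h k).
Proof. by rewrite /h lnK // posrE ltr0n height_gt0 // primitive_neq0 //; exact: mp_P mp k. Qed.

Let sE k : apx xi (x k) = expR (- s k).
Proof. by rewrite /s opprK lnK // posrE (apx_gt0 indep) // primitive_neq0 //; exact: mp_x mp k. Qed.

Let h_ge0 k : 0 <= h k.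
Proof. by rewrite ln_ge0 // ler1n height_gt0 // primitive_neq0 //; exact: mp_P mp k. Qed.

Let h_mono k : h k <= h k.+1.
Proof. by rewrite -ler_expR -!hE ler_nat; exact: mp_mono mp k. Qed.

Let h_infty : forall A : R, eventually_le (fun=> A) h.
Proof.
move=> A; have [k0 hk0] := mp_infty mp (Num.bound (expR A)); exists k0 => k /hk0 hk.
rewrite -ler_expR -hE; apply: le_trans (ltW (archi_boundP (expR_ge0 A))) _.
by rewrite ler_nat ltnW.
Qed.

Let s_ge k : th * h k - c <= s k.
Proof.
have hx : - s k <= ln C - th * h k.
  rewrite -ler_expR -sE expRD lnK //; apply: le_trans (mp_apx mp k) _.
  by rewrite hE -expRM mulrN (mulrC (h k)).
have := ler_norm (ln C); have := pc0; have := ln2; have := gc0; rewrite /c; lra.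
Qed.

Let s_ge_num k : 19 / 8 * h k - c <= s k.
Proof. by apply: le_trans (s_ge k); rewrite lerD2r ler_wpM2r. Qed.

Let x0_neq0 k : 0 < s k -> (x k).1.1 != 0.
Proof.
move=> sk; apply/eqP => x00; have := primitive_neq0 (mp_x mp k).
have [h1 h2] := apx_ge xi (x k); rewrite x00 !mul0r !subr0 sE in h1 h2.
have e1 : expR (- s k) < 1 by rewrite expR_lt1 oppr_lt0.
move/vec_neq0; rewrite x00 eqxx /= => /orP[] /(norm_int_cast_ge1 R); lra.
Qed.

Let uE k : (x k).1.1 != 0 -> `|(x k).1.1%:~R| = expR (u k).
Proof. by move=> x0; rewrite /u lnK // posrE normr_gt0 intr_eq0. Qed.

Let u_le k : (x k.+1).1.1 != 0 -> u k.+1 <= h k + h k.+1 + c.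
Proof.
move=> x0; apply: (@le_trans _ _ (ln 2 + h k + h k.+1)).
  rewrite -ler_expR -uE // !expRD -!hE lnK ?posrE // -!natrM.
  by rewrite -intr_norm -[leRHS]/((_%:Z)%:~R) ler_int; have := mp_x0 mp k; lia.
by have := normr_ge0 (ln C); have := pc0; have := gc0; rewrite /c; lra.
Qed.

Let index k : exists2 n : int, n != 0 & cross (x k) (x k.+1) = scale n (P k).
Proof.
have [n hn] := cross_primitive (mp_P mp k) (mp_perp mp k) (mp_perpS mp k).
exists n => //; have := mp_cross mp k; rewrite hn scale_eq0 // primitive_neq0 //.
exact: mp_P mp k.
Qed.

Let large k := [/\ 0 <= u k, 0 < s k, 0 < s k.+1, 100 * c <= h k & (x k).1.1 != 0
  /\ (x k.+1).1.1 != 0].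

Let large_infty : exists k0, forall k, (k0 <= k)%N -> large k.
Proof.
have [k0 hk0] := h_infty (100 * c); exists k0 => k hk.
have s0 j : (k0 <= j)%N -> 0 < s j.
  by move=> /hk0 hj; have := s_ge_num j; have := c1; lra.
have x0 := x0_neq0 (s0 _ hk); split; [|exact: s0|exact: s0 (leqW hk)|exact: hk0|].
- by rewrite ln_ge0 // norm_int_cast_ge1.
- by split=> //; apply: x0_neq0; exact: s0 (leqW hk).
Qed.

Let h_le k : large k -> large k.+1 -> h k.+1 <= u k.+2 - s k.+1 + c.
Proof.
case=> uk sk sk1 hk [x0 x1] [uk1 _ sk2 hk1 [_ x2]]; have [n n0 hn] := index k.+1.
have hP : (height (P k.+1))%:~R = expR (h k.+1) := hE _.
have u2 : 0 <= u k.+2 by rewrite ln_ge0 // norm_int_cast_ge1.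
have h1 := index_exponent (uE x1) (uE x2) (sE _) (sE _) hP hn u2 (ltW sk2) n0 (h_ge0 _).
have pcc : pc + 1 <= c.
  by have := pc0; have := ln2; have := gc0; have := normr_ge0 (ln C); rewrite /c; lra.
have p0 := pc0; have h2 : h k.+1 <= u k.+2 - s k.+1 + pc.
  (* The side condition of [index_exponent] holds because u_(k+1) <= 2 h_(k+1) + c, whereas s_(k+2)
     >= (19/8) h_(k+1) - c. *)
  have := u_le x1; have := h_mono k; have := h_mono k.+1; have := s_ge_num k.+2.
  by move=> *; apply: h1; rewrite -/pc; lra.
lra.
Qed.

(** A point on the curve would satisfy u_(k+2) <= 3 h_(k+1), whereas u_(k+2) >= h_(k+1) + s_(k+1) >=
    (27/8) h_(k+1) up to constants. *)
Let cubic_neq0 k : large k -> large k.+1 -> large k.+2 -> cubic (x k.+2) != 0.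
Proof.
move=> l0 l1 l2; apply/eqP => hcub.
have [_ _ _ hk [x0 x1]] := l1; have [_ _ _ _ [x2 _]] := l2.
have [b0 b1 b2] := height_ge (P k.+1).
have := cubic_eq0_le (mp_x mp k.+2) x2 hcub (primitive_neq0 (mp_P mp k.+1))
  (mp_perpS mp k.+1) b0 b1 b2.
rewrite -(ler_int R) intr_norm uE // rmorphXn /= -[_%:~R]/(_%:R) hE -expRM_natl ler_expR.
by have := h_le l0 l1; have := s_ge_num k.+1; have := c1; move: hk; lra.
Qed.

Let s_le k : large k -> large k.+1 -> large k.+2 -> s k.+2 <= 2 * u k.+2 + c.
Proof.
move=> l0 l1 l2; have [u2 s2 _ _ [x2 _]] := l2.
have := cubic_exponent (uE x2) (sE _) u2 (ltW s2) (cubic_neq0 l0 l1 l2).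
rewrite -/pc; have := pc0; have := ln2; have := gc0; have := normr_ge0 (ln C).
by rewrite /c; lra.
Qed.

Let gaps k : large k -> large k.+1 -> large k.+2 -> large k.+3 ->
  gap_alternative c (u k.+2) (u k.+3) (s k.+2) (s k.+3) (h k.+2).
Proof.
move=> l0 l1 l2 l3; rewrite /gap_alternative /= => g1 g2 g3 g4.
have [n n0 hn] := index k.+2.
have [u2 s2 _ _ [x2 _]] := l2; have [u3 s3 _ _ [x3 _]] := l3.
have hP : (height (P k.+2))%:~R = expR (h k.+2) := hE _.
have cE : gap_const pc + 12 * pc + 1 <= c.
  by have := ln2; have := normr_ge0 (ln C); rewrite /c; lra.
have p0 := pc0; have q0 := gc0.
have pb := pair_boundsP (uE x2) (uE x3) (sE _) (sE _) hP hn u2 u3 (ltW s2) (ltW s3)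
  (mp_x mp k.+2) (cubic_neq0 l0 l1 l2) (cubic_neq0 l1 l2 l3) g1.
rewrite -/pc in pb; have {}pb := pb ltac:(lra) ltac:(lra).
have K0 : 4 * cubic (x k.+2) * polar (x k.+3) (x k.+2) - polar (x k.+2) (x k.+3) ^+ 2 != 0.
  by apply/eqP => /(gap_K0 pc0 pb); lra.
have bK : u k.+2 + gap_const pc < 2 * s k.+2 by lra.
split.
- have := gap_K_neq0 pc0 pb K0; lra.
- move=> e1 e2; apply: (gap_order2 pc0 pb K0 bK); lra.
- move=> e1 e2 e3 e4; apply: (gap_order36 pc0 pb K0 bK); try lra.
  by case: e4 => [e4|[f1 f2 f3 f4 f5]]; [left; lra | right; split; lra].
Qed.

Lemma no_minimal_points : False.
Proof.
have [k0 hk0] := large_infty.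
(* The shift by two is there because [cubic_neq0] draws on the two preceding indices. *)
pose sh (f : nat -> R) k := f (k0 + k).+2.
have lg j k : large (j + (k0 + k))%N.
  by apply: hk0; rewrite addnCA leq_addr.
have lg0 k : large (k0 + k)%N := lg 0%N k.
have lg1 k : large (k0 + k).+1 := lg 1%N k.
have lg2 k : large (k0 + k).+2 := lg 2%N k.
have lg3 k : large (k0 + k).+3 := lg 3%N k.
apply: (@growth_contradiction R th c (sh u) (sh s) (sh h)) => //; rewrite /sh.
- exact: le_trans c1.
- by move=> k; exact: h_ge0.
- move=> A; have [k1 hk1] := h_infty A; exists k1 => k hk; apply: hk1.
  exact: leq_trans hk (leqW (leqW (leq_addl _ _))).
- by move=> k; exact: s_ge.
- by move=> k; rewrite addnS; apply: u_le; have [_ _ _ _ []] := lg3 k.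
- by move=> k; rewrite addnS; apply: h_le.
- by move=> k; apply: s_le.
- by move=> k; rewrite addnS; apply: gaps.
Qed.
End Contradiction.

Theorem corollary1p4 (R : realType) (mu xi tau : R)
    (hmu : mu = 2 * (9 + Num.sqrt 11) / 35)
    (htau : 1 / (1 - mu) < tau)
    (hP : \forall X \near (+oo : set_system R),
       exists (P : {poly int}) (a b c : int),
         [/\ P != 0,
             P = a *: 'X^3 + b *: 'X + c%:P,
             (Num.max `|a| (Num.max `|b| `|c|))%:~R <= X
           & `| (map_poly intr P).[xi] | <= X `^ (- tau)]) :
  rat_lin_dependent [tuple 1; xi; xi ^+ 3].
Proof.
set r : R := Num.sqrt 11 in hmu.
have r2 : r ^+ 2 = 11 by rewrite sqr_sqrtr.
have r0 : 0 <= r by exact: sqrtr_ge0.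
(* At r = 53/16 the value of (17 + 2 r) / 7 is 27/8 = 19/8 + 1. *)
have r_lo : 53 / 16 < r.
  by rewrite -(@ltr_pXn2r _ 2) ?nnegrE // ?divr_ge0 // r2; lra.
have r_hi : r < 10 / 3.
  by rewrite -(@ltr_pXn2r _ 2) ?nnegrE // ?divr_ge0 // r2; lra.
have tauE : 1 / (1 - mu) = (17 + 2 * r) / 7.
  have d0 : 1 - mu != 0 by rewrite hmu; apply/eqP; lra.
  apply: (mulIf d0); rewrite mulfVK // hmu.
  have -> : (17 + 2 * r) / 7 * (1 - 2 * (9 + r) / 35) = (17 ^+ 2 - 4 * r ^+ 2) / 245 by field.
  by rewrite r2; field.
rewrite tauE in htau.
have th_ge : 19 / 8 <= tau - 1 by lra.
have th_root : 0 < 7 * (tau - 1) ^+ 2 - 20 * (tau - 1) + 8.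
  (* Since r^2 = 11, this product is 7 times the quadratic in tau - 1, so its larger root is the
     bound (17 + 2 r) / 7 for tau. *)
  have : 0 < (7 * tau - 17 - 2 * r) * (7 * tau - 17 + 2 * r) by rewrite mulr_gt0 //; lra.
  by lra.
apply: contrapT => hdep.
have indep (P : vec) : form_val xi P = 0 -> P = 0.
  move=> hval; apply: contrapT => /eqP P0; apply: hdep.
  exists (fun i : 'I_3 => nth 0 [:: P.1.1%:~R; P.1.2%:~R; P.2%:~R] i); split.
    case/or3P: (vec_neq0 P0) => h; [exists ord0 | exists (inord 1) | exists ord_max];
      by rewrite ?inordK //= intr_eq0.
  rewrite !big_ord_recl big_ord0 /= !(tnth_nth 0) /= !ratr_int -[RHS]hval /form_val.
  by rewrite mulr1 addr0 addrA.
have small : exists N0 : nat, forall N : nat, (N0 <= N)%N ->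
    exists P : vec, [/\ P != 0, (height P <= N)%N & `|form_val xi P| <= N%:R `^ (- tau)].
  have [A [_ hA]] := hP; exists (Num.bound `|A|) => N hN.
  have AN : A < N%:R.
    apply: le_lt_trans (ler_norm A) (lt_le_trans (archi_boundP (normr_ge0 A)) _).
    by rewrite ler_nat.
  have [Q [a [b [c [Q0 QE hh hv]]]]] := hA _ AN.
  exists ((c, b), a); split.
  - apply: contra Q0 => /eqP[c0 b0 a0].
    by rewrite QE c0 b0 a0 !scale0r !add0r.
  - move: hh; rewrite -[N%:R]/(N%:Z%:~R) ler_int !ge_max /height /=; lia.
  - move: hv; rewrite QE; congr (`|_| <= _).
    rewrite !rmorphD /= !map_polyZ map_polyXn map_polyX map_polyC /= !hornerE.
    by rewrite /form_val /=; ring.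
have tau1 : 1 < tau by lra.
have [x [P mp]] := minimal_points_of_small indep tau1 small.
have C0 : 0 < 2 * 2 `^ tau :> R by rewrite mulr_gt0 // powR_gt0.
exact: no_minimal_points indep C0 th_ge th_root mp.
Qed.
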